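(* There is a compact set $X\subseteq\mathbb{C}$ such that $R(X)$ has no non-zero, bounded point derivations but such that $R(X)$ is not weakly amenable.
   Context: For a compact set $X\subseteq\mathbb{C}$, $R(X)$ is the closure, in the algebra $C(X)$ of continuous complex-valued functions on $X$ with the uniform norm, of the set of restrictions to $X$ of rational functions with poles off $X$. A point derivation on a commutative unital Banach algebra $A$ at a character $\varphi$ of $A$ is a linear functional $d:A\to\mathbb{C}$ with $d(fg)=\varphi(f)d(g)+\varphi(g)d(f)$ for all $f,g\in A$; it is bounded if it is continuous. (The characters of $R(X)$ are exactly the evaluations at points of $X$.) A commutative Banach algebra $A$ is weakly amenable if there are no non-zero, continuous derivations from $A$ into any commutative Banach $A$-bimodule; equivalently, there are no non-zero, continuous derivations from $A$ into the dual module $A'$, i.e. no non-zero continuous linear maps $D:A\to A'$ with $D(fg)=f\cdot D(g)+g\cdot D(f)$ for all $f,g\in A$, where $(f\cdot\lambda)(h)=\lambda(fh)$ for $f,h\in A$ and $\lambda\in A'$. *)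

(* Defs.v *)
From HB Require Import structures.
From mathcomp Require Import all_boot all_order all_algebra.
From mathcomp Require Import all_classical all_reals all_analysis.
From mathcomp Require Import complex.

Set Implicit Arguments.
Unset Strict Implicit.
Unset Printing Implicit Defensive.

Import Order.TTheory GRing.Theory Num.Theory.
Import numFieldNormedType.Exports.

Local Open Scope classical_set_scope.
Local Open Scope ring_scope.
Local Open Scope complex_scope.

(* R[i] is given the topology and the norm that every numFieldType carries;   *)
(* the norm `|z| is then an element of R[i] with zero imaginary part.         *)
HB.instance Definition _ (R : rcfType) :=
  PseudoPointedMetric.copy R[i] (R[i])^o.
HB.instance Definition _ (R : rcfType) := NormedModule.copy R[i] (R[i])^o.

(* The product is a separate operation because a join of GRing.ComPzRing with *)
(* the normed modules is not possible downstream of Num.NumDomain. The norm   *)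
(* of the unit is not required to be 1, so that the zero algebra, which is    *)
(* R(X) for X empty, is not excluded.                                         *)
HB.mixin Record isComBanachAlg (K : numFieldType) A
    & CompleteNormedModule K A := {
  bone : A ;
  bmul : A -> A -> A ;
  bmulA : associative bmul ;
  bmulC : commutative bmul ;
  bmul1l : left_id bone bmul ;
  bmulDl : left_distributive bmul +%R ;
  bmulZl : forall (k : K) (x y : A), bmul (k *: x) y = k *: bmul x y ;
  bnormM : forall x y : A, `|bmul x y| <= `|x| * `|y| }.

#[short(type="comBanachAlgType")]
HB.structure Definition ComBanachAlg (K : numFieldType) :=
  {A of CompleteNormedModule K A & isComBanachAlg K A}.

Notation "f ** g" := (bmul f g) (at level 40, left associativity) : ring_scope.

Section BanachAlgebra.
Variables (K : numFieldType) (A : comBanachAlgType K).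

Definition character (phi : {scalar A}) : Prop :=
  phi bone = 1 /\ forall f g : A, phi (f ** g) = phi f * phi g.

Definition point_derivation (phi d : {scalar A}) : Prop :=
  forall f g : A, d (f ** g) = phi f * d g + phi g * d f.

Definition has_nonzero_bounded_point_derivation : Prop :=
  exists phi d : {scalar A},
    [/\ character phi, point_derivation phi d, continuous d &
        exists f : A, d f <> 0].

(* In a commutative bimodule the left and right actions coincide, hence the   *)
(* single action. The unit of A is not required to act as the identity.       *)
Record comBanachBimod := ComBanachBimod {
  bimod_sort :> completeNormedModType K ;
  bimod_act : A -> bimod_sort -> bimod_sort ;
  bimod_actDl : forall a b x,
    bimod_act (a + b) x = bimod_act a x + bimod_act b x ;
  bimod_actDr : forall a x y,
    bimod_act a (x + y) = bimod_act a x + bimod_act a y ;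
  bimod_actZl : forall k a x, bimod_act (k *: a) x = k *: bimod_act a x ;
  bimod_actZr : forall k a x, bimod_act a (k *: x) = k *: bimod_act a x ;
  bimod_actA : forall a b x, bimod_act (a ** b) x = bimod_act a (bimod_act b x) ;
  bimod_act_bounded : exists M : K,
    forall a x, `|bimod_act a x| <= M * `|a| * `|x| }.

Definition derivation (E : comBanachBimod) (D : {linear A -> E}) : Prop :=
  forall f g : A, D (f ** g) = bimod_act f (D g) + bimod_act g (D f).

Definition weakly_amenable : Prop :=
  forall (E : comBanachBimod) (D : {linear A -> E}),
    continuous D -> derivation D -> forall f : A, D f = 0.

End BanachAlgebra.

Section complex_topology.
Variable R : realType.
Implicit Types z : R[i].

Lemma ReE_norm z : (complex.Re `|z|)%:C = `|z|.
Proof. by rewrite RRe_real ?normr_real. Qed.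

Lemma Re_norm_ge0 z : 0 <= complex.Re `|z|.
Proof. by rewrite -ler0c ReE_norm. Qed.

Lemma gt0_complexE (e : R[i]) : 0 < e -> e = (complex.Re e)%:C.
Proof. by move=> e0; rewrite RRe_real ?gtr0_real. Qed.

Lemma normr_Re_le z : `|complex.Re z|%:C <= `|z|.
Proof. exact: normc_ge_Re. Qed.

Lemma normr_Im_le z : `|complex.Im z|%:C <= `|z|.
Proof.
case: z => a b; rewrite normc_def/= lecR -sqrtr_sqr ler_sqrt.
  by rewrite lerDr sqr_ge0.
by rewrite addr_ge0 ?sqr_ge0.
Qed.

Lemma normr_le_ReIm z : `|z| <= `|complex.Re z|%:C + `|complex.Im z|%:C.
Proof.
rewrite {1}[z]complexE (le_trans (ler_normD _ _))// normrM.
have -> : `|'i%C| = 1 :> R[i].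
  by rewrite normc_def/= expr0n expr1n add0r sqrtr1.
by rewrite mul1r !normc_def/= !expr0n/= !addr0 !sqrtr_sqr.
Qed.

Lemma Re_contracting z z' :
  `|complex.Re z - complex.Re z'|%:C <= `|z - z'|.
Proof. by rewrite -raddfB; exact: normr_Re_le. Qed.

Lemma complex_complete (F : set_system R[i]) :
  ProperFilter F -> cauchy F -> cvg F.
Proof.
move=> FF /cauchy_ballP Fc.
have half (g : R[i] -> R) : (forall z z', `|g z - g z'|%:C <= `|z - z'|) ->
    cvg (g @ F).
  move=> gle; apply: cauchy_cvg; apply/cauchy_ballP => e e0.
  have /Fc : 0 < e%:C :> R[i] by rewrite ltcR.
  case=> -[P Q] [/= FP FQ] PQ; exists (g @` P, g @` Q) => /=.
    by split; [apply: filterS FP | apply: filterS FQ] => z; exists z.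
  move=> [_ _] [/= [z Pz <-] [z' Qz' <-]].
  have := PQ (z, z') (conj Pz Qz').
  rewrite -!ball_normE /ball_/= => zz'.
  by rewrite -ltcR; exact: le_lt_trans (gle _ _) zz'.
have /cvg_ex[a Fa] : cvg (@complex.Re R @ F) by apply: half; exact: Re_contracting.
have /cvg_ex[b Fb] : cvg (@complex.Im R @ F).
  by apply: half => z z'; rewrite -raddfB; exact: normr_Im_le.
apply/cvg_ex; exists (a +i* b); apply/cvgrPdist_lt => e e0.
have e2 : 0 < complex.Re e / 2 by rewrite divr_gt0// -ltcR -gt0_complexE.
move/cvgrPdist_lt/(_ _ e2) : Fa => Fa; move/cvgrPdist_lt/(_ _ e2) : Fb => Fb.
near=> z; apply: le_lt_trans (normr_le_ReIm _) _.
rewrite (gt0_complexE e0) -raddfD/= ltcR.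
rewrite [ltRHS]splitr ltrD// !raddfB/=.
  by near: z.
by near: z.
Unshelve. all: by end_near. Qed.

HB.instance Definition _ := Uniform_isComplete.Build R[i] complex_complete.

End complex_topology.

Lemma continuous_Re (R : realType) : continuous (@complex.Re R).
Proof.
move=> z U /nbhs_ballP[e /= e0 eU].
exists e%:C => /=; first by rewrite ltcR.
move=> w zw; apply: eU; rewrite -ball_normE /= -ltcR.
exact: le_lt_trans (Re_contracting _ _) zw.
Qed.

Section RX.
Variables (R : realType) (X : set R[i]).
Local Notation C := R[i].

Definition rational_on : set (X -> C) :=
  [set f | exists p q : {poly C},
     (forall z, X z -> q.[z] != 0) /\
     f = (fun z : X => p.[set_val z] / q.[set_val z])].

Definition RX_set : set (X -> C) :=
  [set f | continuous f] `&` closure (rational_on : set {uniform X -> C}).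

(* The carrier of R(X); compactness of X is a parameter because the uniform   *)
(* norm below is only meaningful for bounded functions.                       *)
Definition RX (cX : compact X) : Type := set_type RX_set.

Lemma closure_rational_onP (f : X -> C) :
  closure (rational_on : set {uniform X -> C}) f <->
  forall e : C, 0 < e ->
    exists2 g, rational_on g & forall x, `|f x - g x| < e.
Proof.
split=> [fcl e e0|fcl B /uniform_nbhs[E [/= + EB]]].
  have : nbhs (f : {uniform X -> C}) [set g | forall x, `|f x - g x| < e].
    apply/uniform_nbhs; exists [set xy : C * C | `|xy.1 - xy.2| < e].
    split; last by move=> h /= fh x; exact: fh.
    by rewrite -entourage_ballE; exists e.
  by move=> /fcl[g [/= ? ?]]; exists g.
rewrite -entourage_ballE => -[e /= e0 eE].
have [g rg fg] := fcl _ e0.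
exists g; split => //; apply: EB => x _ /=.
by apply: eE; exact: fg.
Qed.

Lemma continuous_horner (p : {poly C}) : continuous (fun z : C => p.[z]).
Proof.
elim/poly_ind: p => [|p c IH] z.
  rewrite (_ : (fun z => _) = cst 0); first exact: (@cst_continuous C C).
  by apply/funext => ?; rewrite horner0.
rewrite (_ : (fun z => _) = (fun z => p.[z] * z + c)); last first.
  by apply/funext => ?; rewrite !hornerE.
apply: (@continuousD _ _ _ (fun z => p.[z] * z) (cst c)); last first.
  exact: cst_continuous.
by apply: (@continuousM _ _ (fun z => p.[z]) id); [exact: IH | exact: cvg_id].
Qed.

Lemma rational_on_continuous f : rational_on f -> continuous f.
Proof.
move=> [p [q [q0 ->]]] x.
have cv : {for x, continuous (set_val : X -> C)} by exact: initial_continuous.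
apply: (@continuousM _ _ (fun z : X => p.[set_val z])
                         (fun z : X => q.[set_val z]^-1)).
  exact: (continuous_comp cv (@continuous_horner p _)).
apply: (@continuousV _ _ (fun z : X => q.[set_val z])).
  exact/q0/set_valP.
exact: (continuous_comp cv (@continuous_horner q _)).
Qed.

Lemma rational_on_cst (c : C) : rational_on (fun=> c).
Proof.
exists c%:P, 1; split=> [z _|]; first by rewrite hornerE oner_eq0.
by apply/funext => z; rewrite !hornerE divr1.
Qed.

Lemma rational_onD f g : rational_on f -> rational_on g ->
  rational_on (fun x => f x + g x).
Proof.
move=> [p [q [q0 ->]]] [p' [q' [q'0 ->]]]; exists (p * q' + p' * q), (q * q').
split=> [z Xz|]; first by rewrite hornerM mulf_neq0 ?q0 ?q'0.
apply/funext => x; rewrite !hornerE addf_div ?q0 ?q'0//; exact: set_valP.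
Qed.

Lemma rational_onM f g : rational_on f -> rational_on g ->
  rational_on (fun x => f x * g x).
Proof.
move=> [p [q [q0 ->]]] [p' [q' [q'0 ->]]]; exists (p * p'), (q * q').
split=> [z Xz|]; first by rewrite hornerM mulf_neq0 ?q0 ?q'0.
by apply/funext => x; rewrite !hornerM mulf_div.
Qed.

Lemma rational_on_RX f : rational_on f -> RX_set f.
Proof.
move=> rf; split; first exact: rational_on_continuous.
exact: subset_closure.
Qed.

Lemma near_dist (g : X -> C) (x : X) (e : C) : continuous g -> 0 < e ->
  nbhs x [set y | `|g x - g y| < e].
Proof.
move=> gc e0.
exact: (gc x [set z | `|g x - z| < e] (nbhsx_ballx (g x) e e0)).
Qed.

Lemma continuous_dist (g : X -> C) :
  (forall x (e : C), 0 < e -> nbhs x [set y | `|g x - g y| < e]) ->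
  continuous g.
Proof.
move=> gP x U [e /= e0 eU].
by apply: filterS (gP x e e0) => y; exact: eU.
Qed.

Lemma closure_rational_on_RX (f : X -> C) :
  closure (rational_on : set {uniform X -> C}) f -> RX_set f.
Proof.
move=> fcl; split => //; apply: continuous_dist => x e e0.
have e4 : 0 < e / 2 / 2 by rewrite !divr_gt0.
have [g rg fg] := (closure_rational_onP f).1 fcl _ e4.
have := near_dist x (rational_on_continuous rg) e4.
apply: filterS => y /= gxy.
have -> : f x - f y = (f x - g x) + (g x - g y) + (g y - f y).
  by rewrite !addrA subrK subrK.
rewrite (le_lt_trans (ler_normD _ _))// [ltRHS]splitr ltrD//; last first.
  rewrite distrC (lt_trans (fg y))// ltr_pdivrMr//.
  by rewrite mulr_natr mulr2n ltrDl divr_gt0.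
by rewrite (le_lt_trans (ler_normD _ _))// [ltRHS]splitr ltrD.
Qed.

Section compact.
Hypothesis cX : compact X.

Lemma continuous_bounded (f : X -> C) : continuous f ->
  exists M : R, forall x, `|f x| <= M%:C.
Proof.
move=> fc; pose g (x : X) : R := complex.Re `|f x|.
have gc : continuous g.
  move=> x; apply: (@continuous_comp _ _ _ (fun y => `|f y|) (@complex.Re R)).
    by apply: (@continuous_comp _ _ _ f Num.norm);
      [exact: fc | exact: norm_continuous].
  exact: continuous_Re.
have /compact_bounded : compact (valL_ (0 : R) g @` X).
  apply: continuous_compact => //; exact/subspace_valL_continuousP'.
move=> [M [_ /(_ (`|M| + 1))]].
rewrite (le_lt_trans (ler_norm _)) ?ltrDl// => /(_ isT) gM.
exists (`|M| + 1) => x.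
rewrite -ReE_norm lecR.
have /= := gM (g x); rewrite ger0_norm ?Re_norm_ge0//; apply.
exists (set_val x); first exact: set_valP.
by rewrite -[in RHS](@valLK _ _ (0 : R) X g).
Qed.

Lemma RX_submod : submod_closed (mem RX_set : {pred X -> C}).
Proof.
split=> [|k f g]; rewrite !inE.
  exact/rational_on_RX/rational_on_cst.
move=> [fc /closure_rational_onP fcl] [gc /closure_rational_onP gcl]; split.
  move=> x; apply: (@continuousD _ _ _ (cst k \* f) g); last exact: gc.
  by apply: continuousM; [exact: cst_continuous | exact: fc].
apply/closure_rational_onP => e e0.
have k0 : 0 < `|k| + 1 by rewrite ltr_wpDl.
have [|u ru fu] := fcl (e / 2 / (`|k| + 1)); first by rewrite !divr_gt0.
have [|v rv gv] := gcl (e / 2); first by rewrite divr_gt0.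
exists (fun x => k * u x + v x).
  by apply: rational_onD => //; apply: rational_onM => //; exact: rational_on_cst.
move=> x; have -> : (k *: f + g) x - (k * u x + v x) =
  k * (f x - u x) + (g x - v x) by rewrite mulrBr opprD addrACA.
rewrite (le_lt_trans (ler_normD _ _))// [ltRHS](splitr e) ler_ltD//.
have /ltW := fu x; rewrite ler_pdivlMr// => /(le_trans _); apply.
by rewrite normrM mulrC ler_wpM2l// lerDl.
Qed.

Lemma RX_setM f g : RX_set f -> RX_set g -> RX_set (f \* g).
Proof.
move=> [fc /closure_rational_onP fcl] [gc /closure_rational_onP gcl]; split.
  by move=> x; apply: continuousM; [exact: fc | exact: gc].
have [M fM] := continuous_bounded fc; have [N gN] := continuous_bounded gc.
pose B : C := `|M%:C| + `|N%:C| + 1.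
have B0 : 0 < B by rewrite ltr_wpDl ?addr_ge0.
apply/closure_rational_onP => e e0.
have [|u ru fu] := fcl (e / 2 / B); first by rewrite !divr_gt0.
have e2 : 0 < e / 2 / B by rewrite !divr_gt0.
have e21 : 0 < 1 + e / 2 / B by rewrite addr_gt0.
have [|v rv gv] := gcl (e / 2 / B / (1 + e / 2 / B)); first by rewrite divr_gt0.
exists (fun x => u x * v x); first exact: rational_onM.
move=> x; have -> : (f \* g) x - u x * v x =
  f x * (g x - v x) + v x * (f x - u x).
  by rewrite /= !mulrBr (mulrC (v x) (f x)) addrA subrK (mulrC (u x)).
have gv1 : `|g x - v x| < 1.
  by rewrite (lt_le_trans (gv x))// ler_pdivrMr// mul1r lerDr.
have gve : `|g x - v x| < e / 2 / B.
  by rewrite (lt_le_trans (gv x))// ler_pdivrMr// ler_peMr ?ltW// ltrDl.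
have vB : `|v x| <= `|N%:C| + 1.
  have -> : v x = g x - (g x - v x) by rewrite opprB addrC subrK.
  rewrite (le_trans (ler_normB _ _))// lerD ?(ltW gv1)//.
  by rewrite (le_trans (gN x))// real_ler_norm// complex_real.
have fB : `|f x| <= `|M%:C|.
  by rewrite (le_trans (fM x))// real_ler_norm// complex_real.
rewrite (le_lt_trans (ler_normD _ _))// !normrM.
apply: (@le_lt_trans _ _ (`|M%:C| * (e / 2 / B) + (`|N%:C| + 1) * (e / 2 / B))).
  by rewrite lerD// ler_pM// ltW.
rewrite -mulrDl addrA -/B mulrC divfK ?gt_eqF//.
by rewrite [ltRHS](splitr e) ltrDl divr_gt0.
Qed.

End compact.
End RX.

Section RX_algebra.
Variables (R : realType) (X : set R[i]) (cX : compact X).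
Local Notation C := R[i].
Local Notation RX := (RX cX).

HB.instance Definition _ := Choice.on RX.
HB.instance Definition _ := SubType.on RX.

HB.instance Definition _ := GRing.SubChoice_isSubLmodule.Build C (X -> C)
  (mem (@RX_set R X)) RX (GRing.submod_closed_semi (@RX_submod R X)).

Definition RX_norm (f : RX) : C :=
  (sup (range (fun x => complex.Re `|val f x|)))%:C.

Lemma RX_normP (f : RX) x : `|val f x| <= RX_norm f.
Proof.
have [fc _] : RX_set (val f) by exact: set_valP.
have [M fM] := continuous_bounded cX fc.
rewrite -ReE_norm lecR; apply: ub_le_sup; last by exists x.
by exists M => _ [y _ <-]; rewrite -lecR ReE_norm.
Qed.

Lemma RX_norm_ge0 (f : RX) : 0 <= RX_norm f.
Proof.
rewrite ler0c; have [->|/set0P[_ [x _ _]]] :=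
  eqVneq (range (fun x => complex.Re `|val f x|)) set0.
  by rewrite sup0.
by rewrite -ler0c; exact: le_trans (RX_normP f x).
Qed.

Lemma RX_norm_le (f : RX) (M : C) : 0 <= M -> (forall x, `|val f x| <= M) ->
  RX_norm f <= M.
Proof.
move=> M0; rewrite -(RRe_real (ger0_real M0)) => fM; rewrite lecR.
have [->|/set0P ne] := eqVneq (range (fun x => complex.Re `|val f x|)) set0.
  by rewrite sup0 -ler0c RRe_real ?ger0_real.
by apply: ge_sup => // _ [x _ <-]; rewrite -lecR ReE_norm.
Qed.

Lemma RX_ler_normD (f g : RX) : RX_norm (f + g) <= RX_norm f + RX_norm g.
Proof.
apply: RX_norm_le => [|x]; first by rewrite addr_ge0 ?RX_norm_ge0.
rewrite raddfD /= (le_trans (ler_normD _ _))// lerD ?RX_normP//.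
Qed.

Lemma RX_normrZ_le (k : C) (f : RX) : RX_norm (k *: f) <= `|k| * RX_norm f.
Proof.
apply: RX_norm_le => [|x]; first by rewrite mulr_ge0 ?RX_norm_ge0.
have -> : val (k *: f) x = k * val f x by rewrite linearZ.
by rewrite normrM ler_wpM2l ?RX_normP.
Qed.

Lemma RX_normrZ (k : C) (f : RX) : RX_norm (k *: f) = `|k| * RX_norm f.
Proof.
apply/le_anti; rewrite RX_normrZ_le /=.
have [->|k0] := eqVneq k 0; first by rewrite normr0 mul0r RX_norm_ge0.
rewrite mulrC -ler_pdivlMr ?normr_gt0// mulrC -normfV.
by rewrite -[in leLHS](scalerK k0 f) RX_normrZ_le.
Qed.

Lemma RX_normr0_eq0 (f : RX) : RX_norm f = 0 -> f = 0.
Proof.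
move=> f0; apply/val_inj; rewrite raddf0; apply/funext => x.
by apply/eqP; rewrite -normr_le0 -f0 RX_normP.
Qed.

HB.instance Definition _ := Lmodule_isNormed.Build C RX
  RX_ler_normD RX_normrZ RX_normr0_eq0.

Lemma RX_normE (f : RX) : `|f| = RX_norm f. Proof. by []. Qed.

Lemma RX_complete (F : set_system RX) : ProperFilter F -> cauchy F -> cvg F.
Proof.
move=> FF /(@cauchyP C RX) Fc.
have Fx (x : X) : cvg ((fun f : RX => val f x) @ F).
  apply: cauchy_cvg; apply/(@cauchyP C C) => e e0.
  have [f Ff] := Fc _ e0; exists (val f x).
  apply: (@filterS _ F _ _ _ _ Ff) => g; rewrite -!ball_normE /=; apply: le_lt_trans.
  by have := RX_normP (f - g) x; rewrite raddfB.
pose g x := lim ((fun f : RX => val f x) @ F).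
have gP (e : C) f : F (ball f e) -> forall x, `|val f x - g x| <= e.
  move=> Ffe x; apply/ler_addgt0Pr => d d0.
  have /cvgrPdist_lt/(_ _ d0) gx : (fun f : RX => val f x) @ F --> g x.
    exact: Fx.
  near F => h.
  have -> : val f x - g x = (val f x - val h x) + (val h x - g x).
    by rewrite addrA subrK.
  rewrite (le_trans (ler_normD _ _))// lerD//.
    have : ball f e h by near: h.
    rewrite -ball_normE /= => /ltW; apply: le_trans.
    by have := RX_normP (f - h) x; rewrite raddfB.
  by rewrite distrC ltW//; near: h.
have gRX : RX_set g.
  apply: closure_rational_on_RX; apply/closure_rational_onP => e e0.
  have e2 : 0 < e / 2 by rewrite divr_gt0.
  have [f Ff] := Fc _ e2.
  have [_ /closure_rational_onP/(_ _ e2)[u ru fu]] : RX_set (val f).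
    exact: set_valP.
  exists u => // x; have -> : g x - u x = (g x - val f x) + (val f x - u x).
    by rewrite addrA subrK.
  rewrite (le_lt_trans (ler_normD _ _))// [ltRHS]splitr ler_ltD//.
  by rewrite distrC gP.
apply/cvg_ex; exists (exist _ g (mem_set gRX) : RX).
apply/cvgrPdist_le => e e0.
have e2 : 0 < e / 2 by rewrite divr_gt0.
have [f Ff] := Fc _ e2.
near=> h.
have fh : `|f - h| <= e / 2.
  by have : ball f (e / 2) h by [near: h]; rewrite -ball_normE => /ltW.
rewrite RX_normE; apply: RX_norm_le => [|x]; first exact: ltW.
rewrite raddfB (_ : (_ - _) x = (g x - val f x) + (val f x - val h x)).
  rewrite (le_trans (ler_normD _ _))// [leRHS]splitr lerD//.
    by rewrite distrC gP.
  by apply: le_trans fh; have := RX_normP (f - h) x; rewrite raddfB.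
by rewrite addrA subrK.
Unshelve. all: by end_near. Qed.

HB.instance Definition _ := Uniform_isComplete.Build RX RX_complete.

Definition RX_one : RX :=
  exist _ (cst 1) (mem_set (rational_on_RX (rational_on_cst X 1))).

Definition RX_mul (f g : RX) : RX :=
  exist _ (val f \* val g) (mem_set (RX_setM cX (set_valP f) (set_valP g))).

Lemma RX_mulA : associative RX_mul.
Proof. by move=> f g h; apply/val_inj/funext => x /=; rewrite mulrA. Qed.

Lemma RX_mulC : commutative RX_mul.
Proof. by move=> f g; apply/val_inj/funext => x /=; rewrite mulrC. Qed.

Lemma RX_mul1l : left_id RX_one RX_mul.
Proof. by move=> f; apply/val_inj/funext => x /=; rewrite mul1r. Qed.

Lemma RX_mulDl : left_distributive RX_mul +%R.
Proof.
by move=> f g h; apply/val_inj/funext => x; exact: mulrDl.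
Qed.

Lemma RX_mulZl (k : C) (f g : RX) : RX_mul (k *: f) g = k *: RX_mul f g.
Proof.
apply/val_inj/funext => x; apply/esym.
exact: (mulrA k (val f x) (val g x)).
Qed.

Lemma RX_normM (f g : RX) : `|RX_mul f g| <= `|f| * `|g|.
Proof.
rewrite !RX_normE; apply: RX_norm_le => [|x].
  by rewrite mulr_ge0 ?RX_norm_ge0.
by rewrite /= normrM ler_pM ?RX_normP.
Qed.

HB.instance Definition _ := isComBanachAlg.Build C RX
  RX_mulA RX_mulC RX_mul1l RX_mulDl RX_mulZl RX_normM.

End RX_algebra.

(* Main.v *)
(** X is a Swiss cheese: the closed unit disc minus a sequence of open discs D_j
    of radius r_j, centred at b_j, with pairwise disjoint closures. A stage of
    the construction removes discs of radius eps / L^2 around one point of each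
    cell of the lattice of mesh 1/L in the disc of radius 1 - 1/N.

    At a point a of the unit circle, the derivatives at a of the functions z^n
    are unbounded. If |a| < 1, a sum of terms c / (z - b) over the T^2 lattice
    points b of a stage next to a, with |c| = eps / L^2 and suitable phases,
    is bounded by 2 on X as soon as L >= 4 T^2, because at most one term is not
    small. Its derivative at a is about eps * log T, which is as large as one
    likes although the sum of the radii of the stage is only about eps.

    The derivation is D(f)(g) = mean over the unit circle of z f'(z) g(z). Write
    f = f_- + f_+ with the poles of f_- in the unit disc and those of f_+ outside
    the closed disc, and similarly for g. Then
      D(f)(g) = mean (z f_+' g) - mean (z g_+' f),
    each mean is a sum of residues in the D_j, and |f_+'(w)| is at most
    |f| / (1 - |w|)^2 by Cauchy. Hence |D(f)(g)| is at most 2 |f| |g| times the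
    sum of the r_j / (1 - |b_j| - r_j)^2, which is kept finite.

    Contour integrals are limits of averages over the N-th roots of unity, which
    are exact on polynomials of degree less than N. *)

Require Import Defs.
From HB Require Import structures.
From mathcomp Require Import all_boot all_order all_algebra all_solvable all_field.
From mathcomp Require Import all_classical all_reals all_analysis.
From mathcomp Require Import complex ring lra zify.

Set Implicit Arguments.
Unset Strict Implicit.
Unset Printing Implicit Defensive.

Import Order.TTheory GRing.Theory Num.Theory.
Import Normc numFieldNormedType.Exports.

Local Open Scope classical_set_scope.
Local Open Scope ring_scope.
Local Open Scope complex_scope.

(** * Means over the unit circle *)

(** Poles are needed near every point of the open disc, yet the weight must stay finite. Scaling
    reconciles the two: a stage has at most 4 L^2 new discs of radius eps / L^2, so it adds at most
    4 eps N^2 to the weight, whatever L is. Hence eps is fixed first, and T and L are then taken as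
    large as the logarithmic divergence of the lattice sum requires. The closures have to be
    disjoint because the pairing is estimated on the circles that bound finitely many removed discs:
    these circles must lie in X for the norm of R(X) to control f and g there. So each lattice point
    is pushed sideways until its disc misses the circles of all earlier discs. A point that falls
    into an earlier disc needs no new one; it is a pole off X already. Uniform approximation gives
    no control of derivatives. D extends from rational functions to R(X) only because its bound
    involves the sup norms of f and g alone. D is non-zero because the first disc removed is centred
    at 0: then 1/z is in R(X) and D(z)(1/z) = 1. *)

Section modulus.
Variable R : realType.
Local Notation C := R[i].
Implicit Types z w : C.

Lemma normcB z w : normc (z - w) = normc (w - z).
Proof. by rewrite -normcN opprB. Qed.

Lemma normc_ge0 z : 0 <= normc z.
Proof. by case: z => a b; exact: sqrtr_ge0. Qed.

Lemma normc_real (x : R) : normc x%:C = `|x|.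
Proof. by rewrite /= expr0n /= addr0 sqrtr_sqr. Qed.

Lemma normc_eq0 z : (normc z == 0) = (z == 0).
Proof.
apply/eqP/eqP => [/eq0_normc//|->].
exact: normc0.
Qed.

Lemma normc_gt0 z : (0 < normc z) = (z != 0).
Proof. by rewrite lt_def normc_ge0 andbT normc_eq0. Qed.

Lemma normcX z n : normc (z ^+ n) = normc z ^+ n.
Proof.
elim: n => [|n IH]; first by rewrite !expr0 normc1.
by rewrite !exprS normcM IH.
Qed.

Lemma le_normcB z w : normc (z - w) <= normc z + normc w.
Proof. by rewrite -(normcN w) le_normcD. Qed.

Lemma ler_dist_normc z w : normc z - normc w <= normc (z - w).
Proof.
by rewrite lerBlDr; have := le_normcD (z - w) w; rewrite subrK.
Qed.

Lemma le_normc_sum (I : Type) (s : seq I) (P : pred I) (F : I -> C) :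
  normc (\sum_(i <- s | P i) F i) <= \sum_(i <- s | P i) normc (F i).
Proof.
elim/big_rec2: _ => [|i x y _ IH]; first by rewrite normc0.
by rewrite (le_trans (le_normcD _ _))// lerD2l.
Qed.

Lemma Re_le_normc z : `|complex.Re z| <= normc z.
Proof. by rewrite -lecR; exact: normc_ge_Re. Qed.

Lemma Im_le_normc z : `|complex.Im z| <= normc z.
Proof.
case: z => a b; rewrite /= -sqrtr_sqr ler_sqrt.
  by rewrite lerDr sqr_ge0.
by rewrite addr_ge0 ?sqr_ge0.
Qed.

Lemma normcE z : normc z ^+ 2 = complex.Re z ^+ 2 + complex.Im z ^+ 2.
Proof. by case: z => a b /=; rewrite sqr_sqrtr// addr_ge0 ?sqr_ge0. Qed.

End modulus.

(** * Averages over roots of unity *)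

Section roots_of_unity_averages.
Variable R : realType.
Local Notation C := R[i].
Implicit Types (F G : C -> C) (z w v : C).

(** ['X^n - 1] splits and is separable, so it has n distinct roots, and among n distinct n-th roots
    of unity one is primitive. *)
Lemma primitive_root_exists n : (0 < n)%N -> exists z : C, n.-primitive_root z.
Proof.
move=> n0; have [r Dp] := closed_field_poly_normal ('X^n - 1 : {poly C}).
rewrite (monicP _) ?monicXnsubC // scale1r in Dp.
have rn1 : all n.-unity_root r.
  by apply/allP => z; rewrite -root_prod_XsubC -Dp.
have sz_r : (n <= size r)%N.
  by rewrite -ltnS -(size_prod_XsubC _ id) -Dp size_XnsubC.
have [|z] := hasP (has_prim_root n0 rn1 _ sz_r); last by exists z.
by rewrite -separable_prod_XsubC -Dp separable_Xn_sub_1 // pnatr_eq0 -lt0n.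
Qed.

(** The default 1 is taken only at n = 0, where no primitive root exists. *)
Definition zeta n : C :=
  if pselect (exists z : C, n.-primitive_root z) is left e
  then projT1 (cid e) else 1.

Lemma zetaP n : (0 < n)%N -> n.-primitive_root (zeta n).
Proof.
move=> n0; rewrite /zeta; case: pselect => [e|/(_ (primitive_root_exists n0))//].
by case: cid.
Qed.

Lemma zetaX n : (0 < n)%N -> zeta n ^+ n = 1.
Proof. by move=> /zetaP/prim_expr_order. Qed.

Lemma normc_zetaX n k : (0 < n)%N -> normc (zeta n ^+ k) = 1.
Proof.
move=> n0; rewrite normcX; suff -> : normc (zeta n) = 1 by rewrite expr1n.
apply/eqP; rewrite -(@pexpr_eq1 _ _ n) ?normc_ge0//.
by rewrite -normcX zetaX// normc1.
Qed.

Definition avg n F : C := n%:R^-1 * \sum_(k < n) F (zeta n ^+ k).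

Lemma avgD n F G : avg n (fun z => F z + G z) = avg n F + avg n G.
Proof. by rewrite /avg big_split mulrDr. Qed.

Lemma avgZ n c F : avg n (fun z => c * F z) = c * avg n F.
Proof. by rewrite /avg -mulr_sumr mulrCA. Qed.

Lemma eq_avg n F G : (forall z, normc z = 1 -> F z = G z) -> avg n F = avg n G.
Proof.
case: n => [|n] FG; first by rewrite /avg !big_ord0.
by congr (_ * _); apply: eq_bigr => k _; rewrite FG// normc_zetaX.
Qed.

Lemma normc_avg_le n F (M : R) : (0 < n)%N ->
  (forall z, normc z = 1 -> normc (F z) <= M) -> normc (avg n F) <= M.
Proof.
move=> n0 FM; rewrite /avg normcM normcV.
have -> : normc (n%:R : C) = n%:R.
  by rewrite -(rmorph_nat (real_complex R)) normc_real ger0_norm.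
rewrite ler_pdivrMl ?ltr0n//.
apply: (le_trans (le_normc_sum _ _ _)).
apply: (@le_trans _ _ (\sum_(k < n) M)).
  by apply: ler_sum => k _; rewrite FM// normc_zetaX.
by rewrite sumr_const card_ord mulr_natl.
Qed.

(** Orthogonality of characters: for 0 < j < n the powers of z^j form a geometric sum that vanishes,
    so only the constant coefficient survives. The bound on the size of p keeps out exponents that
    are non-zero multiples of n. *)
Lemma sum_horner_prim_root n z (p : {poly C}) : (0 < n)%N ->
  n.-primitive_root z -> (size p <= n)%N ->
  \sum_(k < n) p.[z ^+ k] = n%:R * p`_0.
Proof.
move=> n0 zP sp.
have pE x : p.[x] = \sum_(j < n) p`_j * x ^+ j.
  exact: horner_coef_wide.
under eq_bigr do rewrite pE.
rewrite exchange_big /= (bigD1 (Ordinal n0)) //= [X in _ + X]big1 ?addr0.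
  under eq_bigr do rewrite expr0 mulr1.
  by rewrite sumr_const card_ord mulr_natl.
move=> j jn0; rewrite -mulr_sumr.
have zj : z ^+ j != 1.
  rewrite -(prim_order_dvd zP) gtnNdvd ?ltn_ord// lt0n.
  by apply: contra jn0 => /eqP j0; apply/eqP/val_inj.
suff -> : \sum_(k < n) (z ^+ k) ^+ j = 0 by rewrite mulr0.
have := subrX1 (z ^+ j) n.
rewrite -exprM mulnC exprM (prim_expr_order zP) expr1n subrr => /esym/eqP.
rewrite mulf_eq0 subr_eq0 (negbTE zj) /= => /eqP s0.
by rewrite -[RHS]s0; apply: eq_bigr => k _; rewrite -!exprM mulnC.
Qed.

Lemma prim_rootV n z : n.-primitive_root z -> n.-primitive_root z^-1.
Proof.
move=> zP; have n0 := prim_order_gt0 zP.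
have zn := prim_expr_order zP.
have zu : z != 0 by rewrite (prim_root_eq0 zP) -lt0n.
have -> : z^-1 = z ^+ n.-1.
  apply: (mulfI zu); rewrite divff// -exprS prednK//.
rewrite prim_root_exp_coprime//; exact: coprimePn.
Qed.

(** For continuous F the mean is the integral of F(z) / z over the circle divided by 2 pi i. At n =
    0 the average is the junk value 0. *)
Definition has_mean F v := forall e : R, 0 < e ->
  exists N, forall n, (N <= n)%N -> (0 < n)%N -> normc (avg n F - v) <= e.

Lemma has_meanD F G v w : has_mean F v -> has_mean G w ->
  has_mean (fun z => F z + G z) (v + w).
Proof.
move=> Fv Gw e e0; have e2 : 0 < e / 2 by lra.
have [N1 FN] := Fv _ e2; have [N2 GN] := Gw _ e2.
exists (maxn N1 N2) => n; rewrite geq_max => /andP[n1 n2] n0.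
rewrite avgD opprD addrACA (le_trans (le_normcD _ _))//.
have := FN _ n1 n0; have := GN _ n2 n0; lra.
Qed.

Lemma has_meanZ F c v : has_mean F v -> has_mean (fun z => c * F z) (c * v).
Proof.
move=> Fv e e0; have c0 := normc_ge0 c.
have [|N FN] := Fv (e / (normc c + 1)); first by rewrite divr_gt0//; lra.
exists N => n n1 n0; rewrite avgZ -mulrBr normcM.
have := FN _ n1 n0; rewrite ler_pdivlMr; last lra.
have := normc_ge0 (avg n F - v); nra.
Qed.

Lemma eq_has_mean F G v : (forall z, normc z = 1 -> F z = G z) ->
  has_mean F v -> has_mean G v.
Proof.
by move=> FG Fv e /Fv[N FN]; exists N => n n1 n0; rewrite -(eq_avg n FG) FN.
Qed.

Lemma normc_mean_le F v (M : R) : has_mean F v ->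
  (forall z, normc z = 1 -> normc (F z) <= M) -> normc v <= M.
Proof.
move=> Fv FM; apply/ler_addgt0Pr => e /Fv[N FN].
have /= := FN N.+1 (leqnSn N) isT.
have := normc_avg_le (ltn0Sn N) FM.
have := ler_dist_normc v (avg N.+1 F); rewrite normcB; lra.
Qed.

Lemma has_mean_unique F v w : has_mean F v -> has_mean F w -> v = w.
Proof.
move=> Fv /(has_meanZ (-1)) Fw.
have /(_ 0) := normc_mean_le (has_meanD Fv Fw).
have H : forall z, normc z = 1 -> normc (F z + -1 * F z) <= 0.
  by move=> z _; rewrite mulN1r subrr normc0.
move=> /(_ H); rewrite mulN1r => v0; apply/eqP; rewrite -subr_eq0 -normc_eq0.
by rewrite eq_le v0 normc_ge0.
Qed.

(** Means survive uniform limits on the circle, which reduces the disc algebra to polynomials. *)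
Lemma has_mean_lim F v : (forall e : R, 0 < e -> exists G w,
    [/\ has_mean G w, normc (w - v) <= e &
        forall z, normc z = 1 -> normc (F z - G z) <= e]) ->
  has_mean F v.
Proof.
move=> FG e e0; have e3 : 0 < e / 3 by lra.
have [G [w [Gw wv FGe]]] := FG _ e3; have [N GN] := Gw _ e3.
exists N => n n1 n0.
have -> : avg n F - v = avg n (fun z => F z + -1 * G z) + (avg n G - w) + (w - v).
  by rewrite avgD avgZ; ring.
have d1 : normc (avg n (fun z => F z + -1 * G z)) <= e / 3.
  by apply: normc_avg_le => // z z1; rewrite mulN1r FGe.
have d2 := GN _ n1 n0.
apply: (le_trans (le_normcD _ _)).
have := le_normcD (avg n (fun z => F z + -1 * G z)) (avg n G - w); lra.
Qed.

End roots_of_unity_averages.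

(** * The disc algebra and its mirror image at infinity *)

Section disc_algebra.
Variable R : realType.
Local Notation C := R[i].
Implicit Types (F G : C -> C) (z w v a c : C).

(** The disc algebra, as the uniform closure of the polynomials on the closed disc; only the
    restriction of F to that disc is constrained. *)
Definition disc_approx F := forall e : R, 0 < e ->
  exists p : {poly C}, forall z, normc z <= 1 -> normc (F z - p.[z]) <= e.

Lemma horner_disc_bounded (p : {poly C}) :
  exists2 M : R, 0 < M & forall z, normc z <= 1 -> normc p.[z] <= M.
Proof.
elim/poly_ind: p => [|p c [M M0 pM]].
  by exists 1 => // z _; rewrite horner0 normc0.
exists (M + normc c); first by have := normc_ge0 c; lra.
move=> z z1; rewrite hornerMXaddC (le_trans (le_normcD _ _))// lerD2r normcM.
have := pM _ z1; have := normc_ge0 p.[z]; have := normc_ge0 z; nra.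
Qed.

Lemma disc_approx_bounded F : disc_approx F ->
  exists2 M : R, 0 < M & forall z, normc z <= 1 -> normc (F z) <= M.
Proof.
move=> /(_ 1 ltr01)[p Fp]; have [M M0 pM] := horner_disc_bounded p.
exists (M + 1) => [|z z1]; first lra.
have := ler_dist_normc (F z) p.[z]; have := Fp z z1; have := pM z z1; lra.
Qed.

Lemma disc_approx_horner (p : {poly C}) : disc_approx (horner p).
Proof. by move=> e e0; exists p => z _; rewrite subrr normc0 ltW. Qed.

Lemma eq_disc_approx F G : (forall z, normc z <= 1 -> F z = G z) ->
  disc_approx F -> disc_approx G.
Proof.
by move=> FG Fa e /Fa[p Fp]; exists p => z z1; rewrite -FG// Fp.
Qed.

Lemma disc_approx_cst c : disc_approx (fun=> c).
Proof.
by apply: eq_disc_approx (disc_approx_horner c%:P) => z _; rewrite hornerC.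
Qed.

Lemma disc_approx_id : disc_approx id.
Proof.
by apply: eq_disc_approx (disc_approx_horner 'X) => z _; rewrite hornerX.
Qed.

Lemma disc_approxD F G : disc_approx F -> disc_approx G ->
  disc_approx (fun z => F z + G z).
Proof.
move=> Fa Ga e e0; have e2 : 0 < e / 2 by lra.
have [p Fp] := Fa _ e2; have [q Gq] := Ga _ e2.
exists (p + q) => z z1; rewrite hornerD opprD addrACA.
have := le_normcD (F z - p.[z]) (G z - q.[z]).
have := Fp z z1; have := Gq z z1; lra.
Qed.

Lemma disc_approxM F G : disc_approx F -> disc_approx G ->
  disc_approx (fun z => F z * G z).
Proof.
move=> Fa Ga e e0; have [M M0 FM] := disc_approx_bounded Fa.
have [q Gq] := Ga (e / 2 / M) ltac:(by rewrite !divr_gt0).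
have [N N0 qN] := horner_disc_bounded q.
have [p Fp] := Fa (e / 2 / N) ltac:(by rewrite !divr_gt0).
exists (p * q) => z z1; rewrite hornerM.
have -> : F z * G z - p.[z] * q.[z] = F z * (G z - q.[z]) + (F z - p.[z]) * q.[z].
  by ring.
rewrite (le_trans (le_normcD _ _))// !normcM.
have -> : e = M * (e / 2 / M) + e / 2 / N * N by field; rewrite !gt_eqF.
by rewrite lerD// ler_pM ?normc_ge0// ?FM ?Gq ?Fp ?qN.
Qed.

Lemma disc_approxX F n : disc_approx F -> disc_approx (fun z => F z ^+ n).
Proof.
move=> Fa; elim: n => [|n IH]; first exact: disc_approx_cst.
apply: eq_disc_approx (disc_approxM Fa IH) => z _; by rewrite exprS.
Qed.

Lemma expr_small (t e : R) : 0 <= t -> t < 1 -> 0 < e -> exists n, t ^+ n <= e.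
Proof.
move=> t0 t1 e0.
have /cvgrPdist_le/(_ _ e0)[n _ /(_ n (leqnn n))] : (GRing.exp t @ \oo --> (0 : R)).
  by apply: cvg_expr; rewrite ger0_norm.
rewrite /= sub0r normrN ger0_norm ?exprn_ge0//; by exists n.
Qed.

(** Truncated geometric series: the remainder is exactly (z/a)^n / (z - a), at most |a|^-n / (|a| -
    1) on the disc. *)
Lemma disc_approx_pole a : 1 < normc a -> disc_approx (fun z => (z - a)^-1).
Proof.
move=> a1 e e0; have a0 : a != 0 by rewrite -normc_gt0; lra.
have na0 : 0 < normc a by lra.
have [|||n en] := @expr_small (normc a)^-1 (e * (normc a - 1)).
- by rewrite invr_ge0 ltW.
- by rewrite invf_lt1.
- by rewrite mulr_gt0//; lra.
exists (- a^-1 *: \sum_(i < n) (a^-1 ^+ i *: 'X^i)) => z z1.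
have za : z - a != 0.
  by rewrite subr_eq0; apply: contraTneq a1 => <-; rewrite -leNgt.
have -> : (z - a)^-1 - (- a^-1 *: \sum_(i < n) (a^-1 ^+ i *: 'X^i)).[z] =
    (z / a) ^+ n * (z - a)^-1.
  rewrite hornerZ horner_sum.
  under eq_bigr do rewrite hornerZ hornerXn -exprMn mulrC.
  have := subrX1 (z / a) n.
  set S := \sum_(i < n) _.
  move=> H; have -> : (z / a) ^+ n = 1 + (z / a - 1) * S by rewrite -H addrC subrK.
  by field; rewrite za a0.
rewrite normcM normcV normcX normcM normcV.
have za1 : normc a - 1 <= normc (z - a).
  by rewrite normcB; have := ler_dist_normc a z; lra.
rewrite ler_pdivrMr; last lra.
apply: (@le_trans _ _ ((normc a)^-1 ^+ n)).
  rewrite lerXn2r ?nnegrE ?mulr_ge0 ?invr_ge0 ?normc_ge0//.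
  by rewrite ler_piMl// invr_ge0 ltW.
apply: (le_trans en); by rewrite ler_pM2l.
Qed.

Lemma has_mean_disc F : disc_approx F -> has_mean F (F 0).
Proof.
move=> Fa; apply: has_mean_lim => e /Fa[p Fp].
exists (horner p), p.[0]; split.
- move=> d d0; exists (size p) => n pn n0.
  rewrite /avg (sum_horner_prim_root n0 (zetaP _ n0) pn) -horner_coef0.
  by rewrite mulKf ?pnatr_eq0 -?lt0n// subrr normc0 ltW.
- by rewrite normcB Fp// normc0.
- by move=> z z1; rewrite Fp// z1.
Qed.

(* F is the restriction to the unit circle of a function which is analytic    *)
(* outside the closed disc and equal to c at infinity, read in 1/z.           *)
Definition codisc_approx F c := exists2 G, disc_approx G &
  G 0 = c /\ forall z, normc z = 1 -> F z = G z^-1.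

Lemma has_mean_codisc F c : codisc_approx F c -> has_mean F c.
Proof.
move=> [G Ga [<- FG]]; apply: has_mean_lim => e /Ga[p Gp].
exists (fun z => p.[z^-1]), p.[0]; split.
- move=> d d0; exists (size p) => n pn n0; rewrite /avg.
  under eq_bigr do rewrite -exprVn.
  rewrite (sum_horner_prim_root n0 (prim_rootV (zetaP _ n0)) pn) -horner_coef0.
  by rewrite mulKf ?pnatr_eq0 -?lt0n// subrr normc0 ltW.
- by rewrite normcB Gp// normc0.
- by move=> z z1; rewrite FG// Gp// normcV z1 invr1.
Qed.

Lemma codisc_approxM F G c d : codisc_approx F c -> codisc_approx G d ->
  codisc_approx (fun z => F z * G z) (c * d).
Proof.
move=> [F' Fa [<- FF]] [G' Ga [<- GG]].
exists (fun z => F' z * G' z); first exact: disc_approxM.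
by split=> // z z1; rewrite FF ?GG.
Qed.

Lemma codisc_approxD F G c d : codisc_approx F c -> codisc_approx G d ->
  codisc_approx (fun z => F z + G z) (c + d).
Proof.
move=> [F' Fa [<- FF]] [G' Ga [<- GG]].
exists (fun z => F' z + G' z); first exact: disc_approxD.
by split=> // z z1; rewrite FF ?GG.
Qed.

Lemma codisc_approx_cst c : codisc_approx (fun=> c) c.
Proof. by exists (fun=> c) => //; exact: disc_approx_cst. Qed.

Lemma codisc_approxX F c n : codisc_approx F c ->
  codisc_approx (fun z => F z ^+ n) (c ^+ n).
Proof.
move=> [F' Fa [<- FF]]; exists (fun z => F' z ^+ n); first exact: disc_approxX.
by split=> // z z1; rewrite FF.
Qed.

Lemma normc1_neq0 z : normc z = 1 -> z != 0.
Proof. by move=> z1; rewrite -normc_gt0 z1. Qed.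

(** For a non-zero and u = 1/z the function is -a^-1 / (u - a^-1), whose pole lies outside the
    closed disc. The factor z makes the value at infinity 1; without it, in [codisc_approx_pole],
    the value is 0. *)
Lemma codisc_approx_zpole a : normc a < 1 -> codisc_approx (fun z => z / (z - a)) 1.
Proof.
have [->|a0] := eqVneq a 0 => a1.
  exists (fun=> 1); first exact: disc_approx_cst.
  by split=> // z z1; rewrite subr0 divff// normc1_neq0.
have a'1 : 1 < normc a^-1 by rewrite normcV invf_gt1// normc_gt0.
exists (fun z => - a^-1 * (z - a^-1)^-1).
  by apply: disc_approxM; [exact: disc_approx_cst | exact: disc_approx_pole].
split; first by rewrite sub0r invrN invrK mulrNN mulVf.
move=> z z1; have z0 := normc1_neq0 z1.
have za : z - a != 0 by rewrite subr_eq0; apply: contraTneq a1 => <-; rewrite z1 ltxx.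
have az : a - z != 0 by rewrite -opprB oppr_eq0.
by field; rewrite a0 z0 mulN1r az za.
Qed.

Lemma codisc_approx_pole a : normc a < 1 -> codisc_approx (fun z => (z - a)^-1) 0.
Proof.
move=> a1; have [G Ga [G0 GG]] := codisc_approx_zpole a1.
exists (fun z => z * G z); first exact: disc_approxM disc_approx_id Ga.
split; first by rewrite mul0r.
by move=> z z1; rewrite -GG// mulrA mulVf ?mul1r// normc1_neq0.
Qed.

End disc_algebra.

(** * Rational functions *)

Section partial_fractions.
Variable R : realType.
Local Notation C := R[i].
Implicit Types (P Q : C -> Prop) (f g : C -> C) (z w v a b c : C) (k m : nat).

(* f1 is the derivative of f. *)
Inductive pfrac P : (C -> C) -> (C -> C) -> Prop :=
| pfrac0 : pfrac P (fun=> 0) (fun=> 0)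
| pfrac_mono c k f f1 : pfrac P f f1 ->
    pfrac P (fun z => c * z ^+ k + f z)
            (fun z => c * (k%:R * z ^+ k.-1) + f1 z)
| pfrac_pole c a m f f1 : P a -> pfrac P f f1 ->
    pfrac P (fun z => c * (z - a)^-1 ^+ m.+1 + f z)
            (fun z => c * (- m.+1%:R * (z - a)^-1 ^+ m.+2) + f1 z).

(** [pfrac] prescribes the functions on all of C, and identities between fractions fail at the
    poles, where the inverse is 0. Agreement off P is what products preserve. *)
Definition ratl P f f1 := exists g g1, pfrac P g g1 /\
  forall z, ~ P z -> f z = g z /\ f1 z = g1 z.

Lemma pfrac_sub P Q f f1 : (forall a, P a -> Q a) -> pfrac P f f1 -> pfrac Q f f1.
Proof.
move=> PQ; elim=> [|c k h h1 _ IH|c a m h h1 Pa _ IH]; first exact: pfrac0.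
  exact: pfrac_mono.
by apply: pfrac_pole IH; exact: PQ.
Qed.

Lemma pfrac_ratl P f f1 : pfrac P f f1 -> ratl P f f1.
Proof. by move=> fP; exists f, f1; split. Qed.

Lemma eq_ratl P f f1 g g1 : (forall z, ~ P z -> f z = g z /\ f1 z = g1 z) ->
  ratl P f f1 -> ratl P g g1.
Proof.
move=> fg [h [h1 [hP fh]]]; exists h, h1; split=> // z Pz.
by have [<- <-] := fg z Pz; exact: fh.
Qed.

Lemma pfracD P f f1 g g1 : pfrac P f f1 -> pfrac P g g1 ->
  pfrac P (fun z => f z + g z) (fun z => f1 z + g1 z).
Proof.
move=> fP gP; elim: fP => [|c k h h1 _ IH|c a m h h1 Pa _ IH].
- have -> : (fun z => 0 + g z) = g by apply/funext => z; rewrite add0r.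
  by have -> : (fun z => 0 + g1 z) = g1 by apply/funext => z; rewrite add0r.
- have -> : (fun z => c * z ^+ k + h z + g z) =
            (fun z => c * z ^+ k + (h z + g z)).
    by apply/funext => z; rewrite addrA.
  have -> : (fun z => c * (k%:R * z ^+ k.-1) + h1 z + g1 z) =
            (fun z => c * (k%:R * z ^+ k.-1) + (h1 z + g1 z)).
    by apply/funext => z; rewrite addrA.
  exact: pfrac_mono.
- have -> : (fun z => c * (z - a)^-1 ^+ m.+1 + h z + g z) =
            (fun z => c * (z - a)^-1 ^+ m.+1 + (h z + g z)).
    by apply/funext => z; rewrite addrA.
  have -> : (fun z => c * (- m.+1%:R * (z - a)^-1 ^+ m.+2) + h1 z + g1 z) =
            (fun z => c * (- m.+1%:R * (z - a)^-1 ^+ m.+2) + (h1 z + g1 z)).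
    by apply/funext => z; rewrite addrA.
  exact: pfrac_pole.
Qed.

Lemma pfracZ P d f f1 : pfrac P f f1 ->
  pfrac P (fun z => d * f z) (fun z => d * f1 z).
Proof.
elim=> [|c k h h1 _ IH|c a m h h1 Pa _ IH].
- by rewrite (_ : (fun _ => d * 0) = fun=> 0);
    [exact: pfrac0 | apply/funext => z; rewrite mulr0].
- have -> : (fun z => d * (c * z ^+ k + h z)) =
            (fun z => d * c * z ^+ k + d * h z).
    by apply/funext => z; rewrite mulrDr mulrA.
  have -> : (fun z => d * (c * (k%:R * z ^+ k.-1) + h1 z)) =
            (fun z => d * c * (k%:R * z ^+ k.-1) + d * h1 z).
    by apply/funext => z; rewrite mulrDr mulrA.
  exact: pfrac_mono.
- have -> : (fun z => d * (c * (z - a)^-1 ^+ m.+1 + h z)) =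
            (fun z => d * c * (z - a)^-1 ^+ m.+1 + d * h z).
    by apply/funext => z; rewrite mulrDr mulrA.
  have -> : (fun z => d * (c * (- m.+1%:R * (z - a)^-1 ^+ m.+2) + h1 z)) =
            (fun z => d * c * (- m.+1%:R * (z - a)^-1 ^+ m.+2) + d * h1 z).
    by apply/funext => z; rewrite mulrDr mulrA.
  exact: pfrac_pole.
Qed.

Lemma ratlD P f f1 g g1 : ratl P f f1 -> ratl P g g1 ->
  ratl P (fun z => f z + g z) (fun z => f1 z + g1 z).
Proof.
move=> [f' [f1' [fP ff]]] [g' [g1' [gP gg]]].
exists (fun z => f' z + g' z), (fun z => f1' z + g1' z); split.
  exact: pfracD.
by move=> z Pz; have [-> ->] := ff z Pz; have [-> ->] := gg z Pz.
Qed.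

Lemma ratlZ P d f f1 : ratl P f f1 ->
  ratl P (fun z => d * f z) (fun z => d * f1 z).
Proof.
move=> [f' [f1' [fP ff]]].
exists (fun z => d * f' z), (fun z => d * f1' z); split; first exact: pfracZ.
by move=> z Pz; have [-> ->] := ff z Pz.
Qed.

Lemma ratl_mono P c k :
  ratl P (fun z => c * z ^+ k) (fun z => c * (k%:R * z ^+ k.-1)).
Proof.
apply: eq_ratl (pfrac_ratl (pfrac_mono c k (pfrac0 P))) => z _.
by rewrite !addr0.
Qed.

Lemma ratl_pole P c a m : P a ->
  ratl P (fun z => c * (z - a)^-1 ^+ m.+1)
         (fun z => c * (- m.+1%:R * (z - a)^-1 ^+ m.+2)).
Proof.
move=> Pa.
apply: eq_ratl (pfrac_ratl (pfrac_pole c m Pa (pfrac0 P))) => z _.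
by rewrite !addr0.
Qed.

Lemma ratl_cst P c : ratl P (fun=> c) (fun=> 0).
Proof. by apply: eq_ratl (ratl_mono P c 0) => z _; rewrite !mul0r !mulr0 mulr1. Qed.

Lemma sub_neq0 P z a : P a -> ~ P z -> z - a != 0.
Proof. by move=> Pa Pz; rewrite subr_eq0; apply/eqP => za; apply: Pz; rewrite za. Qed.

(** z / (z - a)^(m+1) = 1 / (z - a)^m + a / (z - a)^(m+1); for m = 0 the first term is a
    constant. *)
Lemma ratlX P f f1 : ratl P f f1 ->
  ratl P (fun z => z * f z) (fun z => f z + z * f1 z).
Proof.
move=> [f' [f1' [fP ff]]].
apply: (@eq_ratl _ (fun z => z * f' z) (fun z => f' z + z * f1' z)).
  by move=> z Pz; have [-> ->] := ff z Pz.
elim: fP {ff f f1} => [|c k h h1 _ IH|c a m h h1 Pa _ IH].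
- by apply: eq_ratl (ratl_cst P 0) => z _; rewrite !mulr0 addr0.
- apply: eq_ratl (ratlD (ratl_mono P c k.+1) IH) => z _ /=.
  by case: k => [|k]; rewrite ?exprS ?expr0 /=; split; ring.
- case: m => [|m].
    apply: eq_ratl (ratlD (ratlD (ratl_cst P c) (ratl_pole (c * a) 0 Pa)) IH).
    by move=> z Pz; have za := sub_neq0 Pa Pz; split; field.
  apply: eq_ratl (ratlD (ratlD (ratl_pole c m Pa) (ratl_pole (c * a) m.+1 Pa)) IH).
  move=> z Pz; have za := sub_neq0 Pa Pz; set u := (z - a)^-1.
  (* Written in u, the identities are rational in u with the power u^m as an atom, which [field] can
     settle. *)
  have -> : z = u^-1 + a by rewrite invrK subrK.
  have u0 : u != 0 by rewrite invr_eq0.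
  by rewrite !exprS -!natr1; split; field.
Qed.

(** Resolvent identity 1 / ((z - a)(z - b)) = (1 / (z - a) - 1 / (z - b)) / (a - b) and induction on
    the order of the pole a; for a = b the order rises by one. *)
Lemma ratl_mulpole P b f f1 : P b -> ratl P f f1 ->
  ratl P (fun z => (z - b)^-1 * f z)
         (fun z => (z - b)^-1 * f1 z - (z - b)^-2 * f z).
Proof.
move=> Pb [f' [f1' [fP ff]]].
apply: (@eq_ratl _ (fun z => (z - b)^-1 * f' z)
  (fun z => (z - b)^-1 * f1' z - (z - b)^-2 * f' z)).
  by move=> z Pz; have [-> ->] := ff z Pz.
elim: fP {ff f f1} => [|c k h h1 _ IH|c a m h h1 Pa _ IH].
- by apply: eq_ratl (ratl_cst P 0) => z _; rewrite !mulr0 subrr.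
- have mono : ratl P (fun z => (z - b)^-1 * z ^+ k)
      (fun z => (z - b)^-1 * (k%:R * z ^+ k.-1) - (z - b)^-2 * z ^+ k).
    elim: k => [|k IHk].
      apply: eq_ratl (ratl_pole 1 0 Pb) => z Pz.
      by have zb := sub_neq0 Pb Pz; split; field.
    apply: eq_ratl (ratlX IHk) => z Pz.
    have zb := sub_neq0 Pb Pz.
    by case: k {IHk} => [|k]; rewrite /= ?exprS -?natr1; split; field.
  apply: eq_ratl (ratlD (ratlZ c mono) IH) => z _.
  by split; ring.
- have pole : ratl P (fun z => (z - b)^-1 * (z - a)^-1 ^+ m.+1)
      (fun z => (z - b)^-1 * (- m.+1%:R * (z - a)^-1 ^+ m.+2)
                - (z - b)^-2 * (z - a)^-1 ^+ m.+1).
    have [ab|ab] := eqVneq a b.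
      apply: eq_ratl (ratl_pole 1 m.+1 Pb) => z Pz.
      have zb := sub_neq0 Pb Pz; rewrite ab !exprS -!natr1.
      by split; field.
    have ab0 : a - b != 0 by rewrite subr_eq0.
    elim: m => [|m IHm].
      apply: eq_ratl (ratlZ (a - b)^-1 (ratlD (ratl_pole 1 0 Pa) (ratl_pole (-1) 0 Pb))).
      move=> z Pz; have zb := sub_neq0 Pb Pz; have za := sub_neq0 Pa Pz.
      by split; field; rewrite ab0 za zb.
    apply: eq_ratl (ratlZ (a - b)^-1 (ratlD (ratl_pole 1 m.+1 Pa) (ratlZ (-1) IHm))).
    move=> z Pz; have zb := sub_neq0 Pb Pz; have za := sub_neq0 Pa Pz.
    by rewrite !exprS -!natr1; split; field; rewrite ab0 za zb.
  apply: eq_ratl (ratlD (ratlZ c pole) IH) => z _.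
  by split; ring.
Qed.

Lemma ratlM P f f1 g g1 : ratl P f f1 -> ratl P g g1 ->
  ratl P (fun z => f z * g z) (fun z => f1 z * g z + f z * g1 z).
Proof.
move=> [f' [f1' [fP ff]]] gP.
apply: (@eq_ratl _ (fun z => f' z * g z) (fun z => f1' z * g z + f' z * g1 z)).
  by move=> z Pz; have [-> ->] := ff z Pz.
elim: fP {ff f f1} => [|c k h h1 _ IH|c a m h h1 Pa _ IH].
- by apply: eq_ratl (ratl_cst P 0) => z _; rewrite !mul0r addr0.
- have mono : ratl P (fun z => z ^+ k * g z)
      (fun z => k%:R * z ^+ k.-1 * g z + z ^+ k * g1 z).
    elim: k => [|k IHk].
      by apply: eq_ratl gP => z _; rewrite !mul0r !mul1r add0r.
    apply: eq_ratl (ratlX IHk) => z _.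
    by case: k {IHk} => [|k]; rewrite /= ?exprS -?natr1; split; ring.
  by apply: eq_ratl (ratlD (ratlZ c mono) IH) => z _; split; ring.
- have pole : ratl P (fun z => (z - a)^-1 ^+ m.+1 * g z)
      (fun z => (- m.+1%:R * (z - a)^-1 ^+ m.+2) * g z
                + (z - a)^-1 ^+ m.+1 * g1 z).
    elim: m => [|m IHm].
      apply: eq_ratl (ratl_mulpole Pa gP) => z Pz.
      by have za := sub_neq0 Pa Pz; split; field.
    apply: eq_ratl (ratl_mulpole Pa IHm) => z Pz.
    have za := sub_neq0 Pa Pz.
    by rewrite !exprS -!natr1; split; field.
  by apply: eq_ratl (ratlD (ratlZ c pole) IH) => z _; split; ring.
Qed.

Lemma ratl_horner P (p : {poly C}) : exists f1, ratl P (horner p) f1.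
Proof.
elim/poly_ind: p => [|p c [f1 IH]].
  by exists (fun=> 0); apply: eq_ratl (ratl_cst P 0) => z _; rewrite horner0.
exists (fun z => p.[z] + z * f1 z + 0).
apply: eq_ratl (ratlD (ratlX IH) (ratl_cst P c)) => z _.
by rewrite hornerMXaddC mulrC.
Qed.

(** q splits with all its roots in P, so p / q arises from p by dividing by one linear factor at a
    time. *)
Lemma ratl_fraction P (p q : {poly C}) : (forall z, ~ P z -> q.[z] != 0) ->
  q != 0 -> exists f1, ratl P (fun z => p.[z] / q.[z]) f1.
Proof.
move=> qP q0; have [r Dq] := closed_field_poly_normal q.
have lq : lead_coef q != 0 by rewrite lead_coef_eq0.
have rP a : a \in r -> P a.
  move=> ar; apply: contrapT => /qP; rewrite Dq hornerZ mulf_eq0 (negbTE lq) /=.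
  by rewrite -/(root _ _) root_prod_XsubC ar.
suff [f1 H] : exists f1, ratl P (fun z => p.[z] / (\prod_(a <- r) ('X - a%:P)).[z]) f1.
  exists (fun z => (lead_coef q)^-1 * f1 z).
  apply: eq_ratl (ratlZ (lead_coef q)^-1 H) => z _; split=> //.
  by rewrite {2}Dq hornerZ invfM mulrCA.
elim: r rP {Dq} => [|a r IH] rP.
  have [f1 pf1] := ratl_horner P p; exists f1; apply: eq_ratl pf1 => z _.
  by rewrite big_nil hornerC divr1.
have [|f1 H] := IH; first by move=> b br; apply: rP; rewrite inE br orbT.
exists (fun z => (z - a)^-1 * f1 z - (z - a)^-2 *
  (p.[z] / (\prod_(a <- r) ('X - a%:P)).[z])).
apply: eq_ratl (ratl_mulpole (rP a (mem_head _ _)) H) => z Pz.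
by rewrite big_cons hornerM hornerXsubC invfM mulrCA.
Qed.

(** Poles without monomials: such a function vanishes at infinity. *)
Inductive principal P : (C -> C) -> (C -> C) -> Prop :=
| principal0 : principal P (fun=> 0) (fun=> 0)
| principal_pole c a m f f1 : P a -> principal P f f1 ->
    principal P (fun z => c * (z - a)^-1 ^+ m.+1 + f z)
                (fun z => c * (- m.+1%:R * (z - a)^-1 ^+ m.+2) + f1 z).

Lemma principal_pfrac P f f1 : principal P f f1 -> pfrac P f f1.
Proof.
by elim=> [|c a m h h1 Pa _ IH]; [exact: pfrac0 | exact: pfrac_pole].
Qed.

Lemma pfrac_split P Q f f1 : pfrac P f f1 -> exists g g1 h h1,
  [/\ principal (fun z => P z /\ Q z) g g1, pfrac (fun z => P z /\ ~ Q z) h h1,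
      f = (fun z => g z + h z) & f1 = (fun z => g1 z + h1 z)].
Proof.
elim=> [|c k f' f1' _ [g [g1 [h [h1 [gQ hQ -> ->]]]]]
        |c a m f' f1' Pa _ [g [g1 [h [h1 [gQ hQ -> ->]]]]]].
- exists (fun=> 0), (fun=> 0), (fun=> 0), (fun=> 0).
  by split; [exact: principal0|exact: pfrac0|apply/funext => z; rewrite addr0..].
- eexists _, _, _, _; split; [exact: gQ|exact: (pfrac_mono c k hQ)| |];
    by apply/funext => z; rewrite addrCA.
- have [Qa|Qa] := pselect (Q a).
    eexists _, _, _, _; split;
      [exact: (principal_pole c m (conj Pa Qa) gQ)|exact: hQ| |];
      by apply/funext => z; rewrite addrA.
  eexists _, _, _, _; split; [exact: gQ|exact: (pfrac_pole c m (conj Pa Qa) hQ)| |];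
    by apply/funext => z; rewrite addrCA.
Qed.

End partial_fractions.

(** * The boundary pairing of rational functions *)

Section boundary_pairing.
Variable R : realType.
Local Notation C := R[i].
Implicit Types (P Q : C -> Prop) (f g : C -> C) (z w v a b c : C) (k m : nat).

Lemma disc_approx_affine_pole b a (r : R) : 0 < r -> r < normc (a - b) ->
  disc_approx (fun z => (b + r%:C * z - a)^-1).
Proof.
move=> r0 ra; have rC : r%:C != 0 by rewrite -normc_eq0 normc_real normr_eq0 gt_eqF.
have d1 : 1 < normc ((a - b) / r%:C).
  by rewrite normcM normcV normc_real gtr0_norm// ltr_pdivlMr// mul1r.
apply: eq_disc_approx (disc_approxM (disc_approx_cst (r%:C)^-1) (disc_approx_pole d1)).
move=> z z1.
by rewrite -invfM; congr _^-1; field.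
Qed.

(** Under w = b + r z the factor r z comes from dw, so the value is the integral of (w - a)^-(m+1)
    over the circle divided by 2 pi i: the residue, 1 for a simple pole and 0 otherwise. *)
Lemma codisc_approx_affine_pole b a (r : R) m : 0 < r -> normc (a - b) < r ->
  codisc_approx (fun z => r%:C * z * (b + r%:C * z - a)^-1 ^+ m.+1) (m == 0%N)%:R.
Proof.
move=> r0 ra; have rC : r%:C != 0 by rewrite -normc_eq0 normc_real normr_eq0 gt_eqF.
have d1 : normc ((a - b) / r%:C) < 1.
  by rewrite normcM normcV normc_real gtr0_norm// ltr_pdivrMr// mul1r.
have [F Fa [F0 FE]] := codisc_approxM
  (codisc_approxM (codisc_approx_cst ((r%:C)^-1 ^+ m)) (codisc_approx_zpole d1))
  (codisc_approxX m (codisc_approx_pole d1)).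
exists F => //; split.
  by rewrite F0 mulr1; case: m {F Fa F0 FE} => [|m]; rewrite ?expr0 ?mulr1// expr0n mulr0.
move=> z z1; rewrite -FE//.
have -> : b + r%:C * z - a = r%:C * (z - (a - b) / r%:C) by field.
rewrite exprS invfM exprMn; set u := (z - _)^-1.
by field.
Qed.

(** The remainder stays in the disc algebra, so that after division by (z - w)^2 every term of the
    expansion has a known mean. *)
Definition taylor_at w f (d : C) := exists2 phi, disc_approx phi &
  forall z, normc z <= 1 -> f z = f w + d * (z - w) + (z - w) ^+ 2 * phi z.

Lemma taylor_atD w f d g e : taylor_at w f d -> taylor_at w g e ->
  taylor_at w (fun z => f z + g z) (d + e).
Proof.
move=> [phi pa pE] [psi qa qE]; exists (fun z => phi z + psi z).
  exact: disc_approxD.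
by move=> z z1; rewrite [f z]pE// [g z]qE//; ring.
Qed.

Lemma taylor_atZ w f d c : taylor_at w f d ->
  taylor_at w (fun z => c * f z) (c * d).
Proof.
move=> [phi pa pE]; exists (fun z => c * phi z).
  by apply: disc_approxM pa; exact: disc_approx_cst.
by move=> z z1; rewrite [f z]pE//; ring.
Qed.

Lemma taylor_atM w f d g e : taylor_at w f d -> taylor_at w g e ->
  taylor_at w (fun z => f z * g z) (d * g w + f w * e).
Proof.
move=> [phi pa pE] [psi qa qE].
have ca (c : C) : disc_approx (fun z => c * (z - w)).
  apply: disc_approxM; first exact: disc_approx_cst.
  by apply: disc_approxD; [exact: disc_approx_id | exact: disc_approx_cst].
have cst := @disc_approx_cst R.
exists (fun z => f w * psi z + (g w * phi z + (d * e +
   (d * (z - w) * psi z + (e * (z - w) * phi z +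
      (1 * (z - w) * phi z * (1 * (z - w) * psi z))))))).
  do !apply: disc_approxD.
  - by apply: disc_approxM.
  - by apply: disc_approxM.
  - exact: cst.
  - by apply: disc_approxM.
  - by apply: disc_approxM.
  - by apply: disc_approxM; apply: disc_approxM.
by move=> z z1; rewrite [f z]pE// [g z]qE//; ring.
Qed.

Lemma taylor_atX w f d n : taylor_at w f d ->
  taylor_at w (fun z => f z ^+ n) (n%:R * f w ^+ n.-1 * d).
Proof.
move=> fd; elim: n => [|n IH].
  exists (fun=> 0); first exact: disc_approx_cst.
  by move=> z _; rewrite !expr0; ring.
have [phi pa pE] := taylor_atM fd IH; exists phi => // z z1.
rewrite exprS pE//; congr (_ + _ * _ + _); first by rewrite exprS.
by case: n {IH phi pa pE} => [|n]; rewrite /= ?exprS -?natr1; ring.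
Qed.

Lemma taylor_at_id w : taylor_at w id 1.
Proof.
exists (fun=> 0); first exact: disc_approx_cst.
by move=> z _; ring.
Qed.

Lemma taylor_at_pole w a : normc w <= 1 -> 1 < normc a ->
  taylor_at w (fun z => (z - a)^-1) (- (w - a)^-2).
Proof.
move=> w1 a1; exists (fun z => (w - a)^-2 * (z - a)^-1).
  by apply: disc_approxM; [exact: disc_approx_cst | exact: disc_approx_pole].
have na z : normc z <= 1 -> z - a != 0.
  by move=> z1; rewrite subr_eq0; apply: contraTneq a1 => <-; rewrite -leNgt.
move=> z z1; field; rewrite !na//.
Qed.

Definition outer P := forall a, P a -> 1 < normc a.
Definition inner P := forall a, P a -> normc a < 1.

Lemma pfrac_outer_taylor P f f1 w : outer P -> pfrac P f f1 -> normc w <= 1 ->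
  taylor_at w f (f1 w).
Proof.
move=> oP fP w1; elim: fP => [|c k h h1 _ IH|c a m h h1 Pa _ IH].
- exists (fun=> 0); first exact: disc_approx_cst.
  by move=> z _; ring.
- apply: taylor_atD IH; apply: taylor_atZ.
  by have := taylor_atX k (taylor_at_id w); rewrite mulr1.
- apply: taylor_atD IH; apply: taylor_atZ.
  have := taylor_atX m.+1 (taylor_at_pole w1 (oP _ Pa)).
  by congr taylor_at; rewrite /= !exprS; field; rewrite subr_eq0;
    apply: contraTneq (oP _ Pa) => <-; rewrite -leNgt.
Qed.

Lemma pfrac_derivative P f f1 : pfrac P f f1 -> exists f2, pfrac P f1 f2.
Proof.
elim=> [|c k h h1 _ [h2 IH]|c a m h h1 Pa _ [h2 IH]].
- by exists (fun=> 0); exact: pfrac0.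
- eexists; rewrite (_ : (fun z => _) = (fun z => c * k%:R * z ^+ k.-1 + h1 z)).
    exact: pfrac_mono IH.
  by apply/funext => z; rewrite mulrA.
- eexists; rewrite (_ : (fun z => _) =
      (fun z => c * - m.+1%:R * (z - a)^-1 ^+ m.+2 + h1 z)).
    exact: pfrac_pole IH.
  by apply/funext => z; rewrite mulrA.
Qed.

Lemma pfrac_outer_disc P f f1 : outer P -> pfrac P f f1 -> disc_approx f.
Proof.
move=> oP; elim=> [|c k h h1 _ IH|c a m h h1 Pa _ IH].
- exact: disc_approx_cst.
- apply: disc_approxD IH; apply: disc_approxM; first exact: disc_approx_cst.
  by apply: disc_approxX; exact: disc_approx_id.
- apply: disc_approxD IH; apply: disc_approxM; first exact: disc_approx_cst.
  by apply: disc_approxX; apply: disc_approx_pole; exact: oP.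
Qed.

Lemma principal_inner_codisc P f f1 : inner P -> principal P f f1 ->
  codisc_approx f 0 /\ codisc_approx (fun z => z * f1 z) 0.
Proof.
move=> iP; elim=> [|c a m h h1 Pa _ [IH IH1]].
- split; first exact: codisc_approx_cst.
  by rewrite (_ : (fun z => _) = fun=> 0); [exact: codisc_approx_cst |
    apply/funext => z; rewrite mulr0].
- have a1 := iP _ Pa; split.
    rewrite -[0]addr0; apply: codisc_approxD IH.
    have := codisc_approxM (codisc_approx_cst c) (codisc_approxX m.+1 (codisc_approx_pole a1)).
    by rewrite expr0n mulr0.
  rewrite -[0]addr0 (_ : (fun z => _) = (fun z =>
      c * - m.+1%:R * (z / (z - a)) * (z - a)^-1 ^+ m.+1 + z * h1 z)).
    apply: codisc_approxD IH1.
    have := codisc_approxM (codisc_approxM (codisc_approx_cst (c * - m.+1%:R))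
      (codisc_approx_zpole a1)) (codisc_approxX m.+1 (codisc_approx_pole a1)).
    by rewrite expr0n mulr0.
  by apply/funext => z; rewrite [_ ^+ m.+2]exprS; ring.
Qed.

(** The integral of a derivative: on the inner part [z * g1 z] vanishes at infinity, on the outer
    part [z * k1 z] vanishes at 0. *)
Lemma mean_derivative P h h1 : (forall a, P a -> normc a != 1) ->
  ratl P h h1 -> has_mean (fun z => z * h1 z) 0.
Proof.
move=> P1 [f [f1 [fP hf]]].
apply: (@eq_has_mean _ (fun z => z * f1 z)).
  move=> z z1; have [|_ ->//] := hf z.
  by move=> /P1; rewrite z1 eqxx.
have [g [g1 [k [k1 [gP kP _ ->]]]]] := pfrac_split (fun a => normc a < 1) fP.
have iP : inner (fun z => P z /\ normc z < 1) by move=> a [].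
have oP : outer (fun z => P z /\ ~ normc z < 1).
  by move=> a [/P1 a1 /negP]; rewrite -leNgt le_eqVlt eq_sym (negbTE a1).
have [_ /has_mean_codisc gm] := principal_inner_codisc iP gP.
have [k2 k2P] := pfrac_derivative kP.
have := has_mean_disc (disc_approxM (@disc_approx_id R) (pfrac_outer_disc oP k2P)).
rewrite mul0r => /(has_meanD gm); rewrite addr0; apply: eq_has_mean => z _.
by rewrite mulrDr.
Qed.

Implicit Types (D : C * R) (H : seq (C * R)).

Lemma circle_sub_neq0 z w : normc w < 1 -> normc z = 1 -> z - w != 0.
Proof. by move=> w1 z1; rewrite subr_eq0; apply: contraTneq w1 => <-; rewrite z1 ltxx. Qed.

(** Cauchy's formula: [h1 w] is the mean of z f / (z - w)^2, because the inner part g only adds a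
    term that vanishes at infinity. So the bound involves the size of f on the circle and not that
    of its outer part. *)
Lemma cauchy_derivative_bound P Q f g g1 h h1 (F : R) w :
  (forall z, normc z = 1 -> normc (f z) <= F) ->
  inner P -> principal P g g1 -> outer Q -> pfrac Q h h1 ->
  (forall z, normc z = 1 -> f z = g z + h z) -> normc w < 1 ->
  normc (h1 w) <= F / (1 - normc w) ^+ 2.
Proof.
move=> fF iP gP oQ hQ fgh w1.
have M : has_mean (fun z => z * f z / (z - w) ^+ 2) (h1 w).
  have [gc _] := principal_inner_codisc iP gP.
  have zp := codisc_approx_zpole w1; have p := codisc_approx_pole w1.
  have m1 := has_mean_codisc (codisc_approxM (codisc_approxM zp p) gc).
  rewrite mulr0 in m1.
  have m2 := has_meanZ (h w) (has_mean_codisc (codisc_approxM zp p)).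
  rewrite !mulr0 in m2.
  have m3 := has_meanZ (h1 w) (has_mean_codisc zp); rewrite mulr1 in m3.
  have [phi pa pE] := pfrac_outer_taylor oQ hQ (ltW w1).
  have m4 := has_mean_disc (disc_approxM (@disc_approx_id R) pa).
  rewrite mul0r in m4.
  have := has_meanD m1 (has_meanD m2 (has_meanD m3 m4)).
  rewrite addr0 !add0r; apply: eq_has_mean => z z1.
  rewrite fgh// [h z]pE ?z1//.
  by have zw := circle_sub_neq0 w1 z1; field.
apply: (normc_mean_le M) => z z1.
have d : 1 - normc w <= normc (z - w).
  by have := ler_dist_normc z w; rewrite z1.
rewrite normcM normcM normcV normcX z1 mul1r.
rewrite ler_pM ?normc_ge0 ?fF//.
  by rewrite invr_ge0 exprn_ge0 ?normc_ge0.
rewrite lef_pV2 ?posrE ?exprn_gt0//; last 2 first.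
  by rewrite (lt_le_trans _ d)// subr_gt0.
  by rewrite subr_gt0.
by rewrite lerXn2r ?nnegrE ?normc_ge0// subr_ge0 ltW.
Qed.

(** * Residues and the bound for the pairing *)

Definition disjoint_discs H :=
  pairwise (fun D D' => D.2 + D'.2 < normc (D.1 - D'.1)) H.

Definition disc_in_disc D := (0 < D.2) && (normc D.1 + D.2 < 1).

Definition good_discs H := disjoint_discs H && all disc_in_disc H.

Definition in_discs H a := exists2 D, D \in H & normc (a - D.1) < D.2.

Lemma good_discsP H : good_discs H -> uniq H /\
  {in H &, forall D D', D != D' -> D.2 + D'.2 < normc (D.1 - D'.1)}.
Proof.
elim: H => [|D H IH]; first by split.
rewrite /good_discs /disjoint_discs /= => /andP[/andP[DH dH] /andP[D1 aH]].
have [uH hH] := IH (introT andP (conj dH aH)).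
split.
  rewrite uH andbT; apply/negP => /(allP DH); rewrite subrr normc0.
  by case/andP: D1 => ? _; lra.
move=> E E'; rewrite !inE => /orP[/eqP->|EH] /orP[/eqP->|EH'].
- by rewrite eqxx.
- by move=> _; exact: (allP DH _ EH').
- by move=> _; rewrite addrC normcB; exact: (allP DH _ EH).
- exact: hH.
Qed.

Definition circle_pt D z : C := D.1 + (D.2)%:C * z.

Lemma circle_ptP D z : 0 < D.2 -> normc z = 1 -> normc (circle_pt D z - D.1) = D.2.
Proof.
move=> D0 z1; rewrite /circle_pt addrAC subrr add0r normcM z1 mulr1.
by rewrite normc_real gtr0_norm.
Qed.

Lemma normc_circle_pt D z : 0 < D.2 -> normc z <= 1 ->
  normc (circle_pt D z) <= normc D.1 + D.2.
Proof.
move=> D0 z1; rewrite (le_trans (le_normcD _ _))// lerD2l normcM normc_real.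
by rewrite gtr0_norm// ler_piMr// ltW.
Qed.

(** Induction over partial fractions. A simple pole in a disc D0 adds its coefficient to the mean
    over the unit circle and to the one over the circle of D0; everything else adds 0 on both
    sides. *)
Lemma residue_theorem H P h h1 : good_discs H ->
  (forall a, P a -> 1 < normc a \/ in_discs H a) -> pfrac P h h1 ->
  exists v : C * R -> C, has_mean (fun z => z * h z) (\sum_(D <- H) v D) /\
  forall D, D \in H -> has_mean (fun z => (D.2)%:C * z * h (circle_pt D z)) (v D).
Proof.
move=> gH PH; have [uH dH] := good_discsP gH.
have HD D : D \in H -> 0 < D.2 /\ normc D.1 + D.2 < 1.
  by move: gH => /andP[_ /allP aH] /aH/andP.
have id0 (r b : C) : disc_approx (fun z => b + r * z).
  apply: disc_approxD; first exact: disc_approx_cst.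
  by apply: disc_approxM; [exact: disc_approx_cst | exact: disc_approx_id].
have idr (r : C) : disc_approx (fun z => r * z).
  by apply: disc_approxM; [exact: disc_approx_cst | exact: disc_approx_id].
elim=> [|c k f f1 _ [v [vM vD]]|c a m f f1 Pa _ [v [vM vD]]].
- exists (fun=> 0); rewrite big1//; split=> [|D _].
    by have := has_mean_disc (@disc_approx_cst R 0); apply: eq_has_mean => z _; ring.
  by have := has_mean_disc (@disc_approx_cst R 0); apply: eq_has_mean => z _; ring.
- exists v; split.
    rewrite -[X in has_mean _ X]add0r.
    have m0 := has_mean_disc (disc_approxM (@disc_approx_cst R c)
      (disc_approxM (@disc_approx_id R) (disc_approxX k (@disc_approx_id R)))).
    rewrite mul0r mulr0 in m0.
    have := has_meanD m0 vM; apply: eq_has_mean => z _; ring.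
  move=> D DH; rewrite -[v D]add0r.
  have m0 := has_mean_disc (disc_approxM (@disc_approx_cst R c)
      (disc_approxM (idr (D.2)%:C) (disc_approxX k (id0 (D.2)%:C D.1)))).
  rewrite !(mulr0, mul0r) in m0.
  have := has_meanD m0 (vD D DH); apply: eq_has_mean => z _.
  by rewrite /circle_pt; ring.
have outside D : D \in H -> D.2 < normc (a - D.1) ->
    has_mean (fun z => (D.2)%:C * z * (c * (circle_pt D z - a)^-1 ^+ m.+1)) 0.
  move=> DH aD; have [D0 _] := HD D DH.
  have m0 := has_mean_disc (disc_approxM (disc_approxM (idr (D.2)%:C) (@disc_approx_cst R c))
    (disc_approxX m.+1 (disc_approx_affine_pole D0 aD))).
  rewrite !(mulr0, mul0r) in m0.
  by apply: eq_has_mean m0 => z _; rewrite /circle_pt mulrA.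
have [a1|[D0 DH0 aD0]] := PH a Pa.
  exists v; split.
    rewrite -[X in has_mean _ X]add0r.
    have m0 := has_mean_disc (disc_approxM (disc_approxM (@disc_approx_id R)
       (@disc_approx_cst R c)) (disc_approxX m.+1 (disc_approx_pole a1))).
    rewrite !mul0r in m0.
    by have := has_meanD m0 vM; apply: eq_has_mean => z _; rewrite mulrDr mulrA.
  move=> D DH; rewrite -[v D]add0r.
  have aD : D.2 < normc (a - D.1).
    by have := ler_dist_normc a D.1; have [] := HD D DH; lra.
  by have := has_meanD (outside D DH aD) (vD D DH);
     apply: eq_has_mean => z _; rewrite mulrDr.
exists (fun D => c * (m == 0%N)%:R * (D == D0)%:R + v D); split.
  have a1 : normc a < 1.
    have [_] := HD D0 DH0.
    have := le_normcD (a - D0.1) D0.1; rewrite subrK; lra.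
  rewrite big_split /= -mulr_sumr.
  have -> : \sum_(D <- H) (D == D0)%:R = 1 :> C.
    by rewrite (bigD1_seq D0)//= eqxx big1 ?addr0// => D /negbTE ->.
  rewrite mulr1.
  (* The unit circle is the affine circle with centre 0 and radius 1. *)
  have a01 : normc (a - 0) < 1 by rewrite subr0.
  have m0 := has_meanZ c (has_mean_codisc (codisc_approx_affine_pole m ltr01 a01)).
  have := has_meanD m0 vM; apply: eq_has_mean => z _.
  by rewrite add0r mul1r; ring.
move=> D DH; have [r0 _] := HD D DH.
have [DD0|DD0] := eqVneq D D0.
  rewrite mulr1; have aD : normc (a - D.1) < D.2 by rewrite DD0.
  have m0 := has_meanZ c (has_mean_codisc (codisc_approx_affine_pole m r0 aD)).
  have := has_meanD m0 (vD D DH); apply: eq_has_mean => z _.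
  by rewrite /circle_pt; ring.
rewrite mulr0.
have aD : D.2 < normc (a - D.1).
  have := dH _ _ DH DH0 DD0.
  have := le_normcD (D.1 - a) (a - D0.1); rewrite addrA subrK (normcB D.1 a); lra.
by have := has_meanD (outside D DH aD) (vD D DH);
     apply: eq_has_mean => z _; rewrite mulrDr.
Qed.

Definition disc_weight H : R := \sum_(D <- H) D.2 / (1 - normc D.1 - D.2) ^+ 2.

Definition discs_boundary H z :=
  normc z = 1 \/ exists2 D, D \in H & normc (z - D.1) = D.2.

(** The residue theorem moves the mean from the unit circle, where [h1] has no bound, to the circles
    of H, where Cauchy's estimate gives |h1| <= F / (1 - |b| - r)^2. *)
Lemma half_pairing H P Q f g g1 h h1 (k k1 : C -> C) (F G : R) : good_discs H ->
  (forall a, P a -> 1 < normc a \/ in_discs H a) ->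
  (forall z, discs_boundary H z -> ~ P z) ->
  (forall z, discs_boundary H z -> normc (f z) <= F) ->
  (forall z, discs_boundary H z -> normc (k z) <= G) ->
  inner (fun a => P a /\ Q a) -> principal (fun a => P a /\ Q a) g g1 ->
  outer (fun a => P a /\ ~ Q a) -> pfrac (fun a => P a /\ ~ Q a) h h1 ->
  f = (fun z => g z + h z) -> pfrac P k k1 ->
  exists2 v, has_mean (fun z => z * h1 z * k z) v &
    normc v <= disc_weight H * F * G.
Proof.
move=> gH PH bP fF kG iP gP oP hP fgh kP.
have hPP : pfrac P h h1 by apply: pfrac_sub hP => a [].
have [h2 hP1] := pfrac_derivative hPP.
have [e [e1 [eP eE]]] := ratlM (pfrac_ratl hP1) (pfrac_ratl kP).
have [v [vM vD]] := residue_theorem gH PH eP.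
exists (\sum_(D <- H) v D).
  apply: eq_has_mean vM => z z1.
  by have [<- _] := eE z (bP z (or_introl z1)); rewrite mulrA.
apply: (le_trans (le_normc_sum _ _ _)).
rewrite /disc_weight !mulr_suml big_seq [leRHS]big_seq.
apply: ler_sum => D DH.
have [r0 r1] : 0 < D.2 /\ normc D.1 + D.2 < 1.
  by move: gH => /andP[_ /allP aH]; have /andP[] := aH D DH.
have F0 : 0 <= F.
  by apply: le_trans (fF 1 _); [exact: normc_ge0 | left; rewrite normc1].
apply: (normc_mean_le (vD D DH)) => z z1.
have zb : discs_boundary H (circle_pt D z) by right; exists D => //; exact: circle_ptP.
have [<- _] := eE _ (bP _ zb).
have wD : normc (circle_pt D z) <= normc D.1 + D.2.
  by apply: normc_circle_pt; rewrite ?z1.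
have w1 : normc (circle_pt D z) < 1 by exact: le_lt_trans r1.
have hb := cauchy_derivative_bound (f := f) (F := F) (fun z Hz => fF z (or_introl Hz))
  iP gP oP hP (fun z _ => congr1 (@^~ z) fgh) w1.
rewrite !normcM z1 mulr1 normc_real gtr0_norm//.
have -> : D.2 / (1 - normc D.1 - D.2) ^+ 2 * F * G =
          D.2 * ((F / (1 - normc D.1 - D.2) ^+ 2) * G).
  by field; rewrite gt_eqF//; lra.
rewrite ler_pM2l// ler_pM ?normc_ge0 ?kG//.
apply: (le_trans hb); rewrite ler_wpM2l//.
rewrite lef_pV2 ?posrE ?exprn_gt0//; try lra.
by rewrite lerXn2r ?nnegrE//; lra.
Qed.

(* Integration by parts moves the derivative from the inner part of f to the  *)
(* outer part of g, and derivatives of outer parts are bounded on the discs.  *)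
Theorem boundary_pairing_bound H P f f1 g g1 (F G : R) : good_discs H ->
  (forall a, P a -> 1 < normc a \/ in_discs H a) ->
  (forall z, discs_boundary H z -> ~ P z) ->
  (forall z, discs_boundary H z -> normc (f z) <= F) ->
  (forall z, discs_boundary H z -> normc (g z) <= G) ->
  pfrac P f f1 -> pfrac P g g1 ->
  exists2 v, has_mean (fun z => z * f1 z * g z) v &
    normc v <= 2 * disc_weight H * F * G.
Proof.
move=> gH PH bP fF gG fP gP.
have HD D : D \in H -> 0 < D.2 /\ normc D.1 + D.2 < 1.
  by move: gH => /andP[_ /allP aH] /aH/andP.
have P1 a : P a -> normc a != 1.
  move=> Pa; apply/eqP => a1; have [|[D DH aD]] := PH a Pa; first by rewrite a1 ltxx.
  have [_] := HD D DH; have := le_normcD (a - D.1) D.1; rewrite subrK; lra.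
pose Q a := normc a < 1.
have iP : inner (fun a => P a /\ Q a) by move=> a [].
have oP : outer (fun a => P a /\ ~ Q a).
  by move=> a [/P1 a1 /negP]; rewrite -leNgt le_eqVlt eq_sym (negbTE a1).
have [fm [fm1 [fp [fp1 [fmP fpP fE f1E]]]]] := pfrac_split Q fP.
have [gm [gm1 [gp [gp1 [gmP gpP gE g1E]]]]] := pfrac_split Q gP.
have [v vM vle] := half_pairing gH PH bP fF gG iP fmP oP fpP fE gP.
have [w wM wle] := half_pairing gH PH bP gG fF iP gmP oP gpP gE fP.
exists (v + -1 * w); last first.
  rewrite mulN1r; apply: (le_trans (le_normcB _ _)).
  have -> : 2 * disc_weight H * F * G =
     disc_weight H * F * G + disc_weight H * G * F by ring.
  exact: lerD.
(* Beyond the two halves, z f1 g consists of z fm1 gm, which vanishes at infinity, of z (fm gp)',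
   whose mean is the integral of a derivative, and of z fp gp1, which vanishes at 0. *)
have [_ fmc] := principal_inner_codisc iP fmP.
have [gmc _] := principal_inner_codisc iP gmP.
have m1 := has_mean_codisc (codisc_approxM fmc gmc); rewrite mulr0 in m1.
have fmPP : pfrac P fm fm1 by apply: pfrac_sub (principal_pfrac fmP) => a [].
have gpPP : pfrac P gp gp1 by apply: pfrac_sub gpP => a [].
have m2 := mean_derivative P1 (ratlM (pfrac_ratl fmPP) (pfrac_ratl gpPP)).
have [gp2 gp2P] := pfrac_derivative gpP.
have m3 := has_mean_disc (disc_approxM (@disc_approx_id R)
  (disc_approxM (pfrac_outer_disc oP fpP) (pfrac_outer_disc oP gp2P))).
rewrite mul0r in m3.
have := has_meanD (has_meanD vM (has_meanZ (-1) wM)) (has_meanD m1 (has_meanD m2 m3)).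
rewrite !addr0; apply: eq_has_mean => z _.
by rewrite f1E gE fE; ring.
Qed.

End boundary_pairing.

(** * The Swiss cheese *)

(** Each D excludes at most two candidates; discarding them disc by disc leaves at least one. *)
Lemma pigeonhole_two (T : eqType) (I : eqType) (H : seq I) (bad : I -> pred T)
    (s : seq T) : uniq s ->
  (forall D x y z, D \in H -> bad D x -> bad D y -> bad D z ->
     [|| x == y, y == z | x == z]) ->
  (2 * size H < size s)%N ->
  exists2 x, x \in s & forall D, D \in H -> ~~ bad D x.
Proof.
elim: H s => [|D H IH] s us bH /=.
  by case: s us => [//|x s] _ _; exists x => //; rewrite inE eqxx.
move=> sz; have ub := filter_uniq (bad D) us.
have b2 : (size (seq.filter (bad D) s) <= 2)%N.
  have bP x : x \in seq.filter (bad D) s -> bad D x by rewrite mem_filter => /andP[].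
  case: (seq.filter (bad D) s) ub bP => [//|x [//|y [//|z t]]] /=.
  rewrite !inE !negb_or => /and3P[/and3P[xy xz _] /andP[yz _] _] bP.
  have := bH D x y z (mem_head _ _) (bP _ _) (bP _ _) (bP _ _).
  rewrite !inE !eqxx !orbT (negbTE xy) (negbTE yz) (negbTE xz).
  by move=> /(_ isT isT isT).
have [E x y z EH||x] := IH (seq.filter (predC (bad D)) s) (filter_uniq _ us).
- by apply: bH; rewrite inE EH orbT.
- have := count_predC (bad D) s; rewrite -!size_filter; lia.
rewrite mem_filter => /andP[/= bx xs] xH; exists x => // E.
by rewrite inE => /orP[/eqP->//|/xH].
Qed.

Lemma uniq_pairwise (T : eqType) (r : rel T) (s : seq T) : uniq s ->
  {in s &, forall x y, x != y -> r x y} -> pairwise r s.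
Proof.
elim: s => [//|x s IH] /= /andP[xs us] rs; apply/andP; split.
  apply/allP => y ys; apply: rs; rewrite ?inE ?eqxx ?ys ?orbT//.
  by apply: contraNneq xs => ->.
by apply: IH => // y z ys zs; apply: rs; rewrite inE ?ys ?zs orbT.
Qed.

Section swiss_cheese.
Variable R : realType.
Local Notation C := R[i].
Implicit Types (D : C * R) (H : seq (C * R)).

Lemma normc_le_ReIm (z : C) : normc z <= `|complex.Re z| + `|complex.Im z|.
Proof.
rewrite -(@ler_pXn2r _ 2) ?nnegrE ?addr_ge0 ?normc_ge0// normcE.
rewrite -(real_normK (num_real (complex.Re z))) -(real_normK (num_real (complex.Im z))).
have := normr_ge0 (complex.Re z); have := normr_ge0 (complex.Im z); nra.
Qed.

Lemma ler1_distn (t u : nat) : t != u -> 1 <= `|t%:R - u%:R| :> R.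
Proof.
wlog tu : t u / (t < u)%N => [H ne|_].
  case: (ltngtP t u) ne => // [tu|ut] _; first by rewrite H// ltn_eqF.
  by rewrite distrC H// ltn_eqF.
by rewrite distrC -natrB ?(ltnW tu)// normr_nat ler1n subn_gt0.
Qed.

(* The squared distance to a point is quadratic in t with leading coefficient *)
(* s^2, hence its values at three parameters cannot all be close together.    *)
Lemma circle_meets_twice (p c : C) (s r rho : R) (t u v : nat) :
  0 <= r -> r <= 1 -> 0 <= rho -> rho <= 1 -> 9 * rho < s ^+ 2 ->
  (forall w, w \in [:: t; u; v] ->
    r - rho <= normc (p + (s * w%:R)%:C - c) <= r + rho) ->
  [|| t == u, u == v | t == v].
Proof.
move=> r0 r1 rho0 rho1 srho H; apply: contraT; rewrite !negb_or => /and3P[tu uv tv].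
pose x := complex.Re (p - c); pose y := complex.Im (p - c).
pose e w : R := (x + s * w) ^+ 2 + y ^+ 2 - r ^+ 2.
have eP (w : nat) : w \in [:: t; u; v] -> `|e w%:R| <= 3 * rho.
  move=> /H; set d := normc _ => /andP[d1 d2].
  have -> : e w%:R = d ^+ 2 - r ^+ 2.
    rewrite /d normcE /e /x /y; case: (p) (c) => [a b] [a' b'] /=; ring.
  have d0 : 0 <= d by exact: normc_ge0.
  by rewrite ler_norml; apply/andP; split; nra.
have et := eP t ltac:(by rewrite !inE eqxx).
have eu := eP u ltac:(by rewrite !inE eqxx orbT).
have ev := eP v ltac:(by rewrite !inE eqxx !orbT).
have := ler1_distn tu; have := ler1_distn uv; have := ler1_distn tv.
(* The second divided difference of e, cleared of denominators; it equals the leading coefficient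
   s^2. The differences of the parameters are at least 1 in modulus, as these are distinct
   integers. *)
have : s ^+ 2 * ((t%:R - u%:R) * (u%:R - v%:R) * (t%:R - v%:R)) =
   e t%:R * (u%:R - v%:R) - e u%:R * (t%:R - v%:R) + e v%:R * (t%:R - u%:R).
  by rewrite /e; ring.
move: (t%:R - u%:R : R) (u%:R - v%:R : R) (t%:R - v%:R : R) => A B E hE.
move=> E1 B1 A1.
have : s ^+ 2 * (`|A| * `|B| * `|E|) <= 3 * rho * (`|A| + `|B| + `|E|).
  rewrite -!normrM -(ger0_norm (sqr_ge0 s)) -normrM hE.
  apply: (le_trans (ler_normD _ _)); apply: (@le_trans _ _
    (`|e t%:R * B| + `|e u%:R * E| + `|e v%:R * A|)).
    by rewrite lerD2r ler_normB.
  rewrite !normrM !mulrDr.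
  have := ler_wpM2r (normr_ge0 A) ev; have := ler_wpM2r (normr_ge0 B) et.
  have := ler_wpM2r (normr_ge0 E) eu; lra.
move: `|A| `|B| `|E| A1 B1 E1 => {hE} a b d a1 b1 d1.
have ab : 1 <= a * b by nra.
have ad : 1 <= a * d by nra.
have bd : 1 <= b * d by nra.
have i1 : a <= a * b * d by nra.
have i2 : b <= a * b * d by nra.
have i3 : d <= a * b * d by nra.
have i4 : 1 <= a * b * d by nra.
have : 3 * rho * (a + b + d) <= 9 * rho * (a * b * d) by nra.
nra.
Qed.

Definition avoids H (rho : R) (b : C) := forall D, D \in H ->
  normc (b - D.1) + rho < D.2 \/ D.2 + rho < normc (b - D.1).

(** Candidates lie at spacing s on a horizontal line. The annulus of half-width rho about each
    circle contains at most two of them, so one more than twice the number of discs is enough. *)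
Lemma exists_avoiding_point H (p : C) (s rho : R) : good_discs H ->
  0 <= rho -> rho <= 1 -> 9 * rho < s ^+ 2 ->
  exists2 t, (t <= 2 * size H)%N & avoids H rho (p + (s * t%:R)%:C).
Proof.
move=> gH rho0 rho1 srho.
pose bad D t := D.2 - rho <= normc (p + (s * t%:R)%:C - D.1) <= D.2 + rho.
have [||t] := @pigeonhole_two _ _ H bad (iota 0 (2 * size H).+1) (iota_uniq _ _).
- move=> D t u v DH bt bu bv.
  have /andP[D0 D1] : disc_in_disc D by move: gH => /andP[_ /allP]; exact.
  apply: (@circle_meets_twice p D.1 s D.2 rho) => //.
  + exact: ltW.
  + by have := normc_ge0 D.1; lra.
  + by move=> w; rewrite !inE => /or3P[] /eqP->.
- by rewrite size_iota.
rewrite mem_iota add0n ltnS => /andP[_ tH] tP; exists t => // D /tP.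
by rewrite /bad negb_and -!ltNge => /orP[]; [left|right]; lra.
Qed.

End swiss_cheese.

(** * Perturbed lattices and lattice sums *)

Section swiss_cheese.
Variable R : realType.
Local Notation C := R[i].
Implicit Types (D : C * R) (H : seq (C * R)).

(** Cell centres of the lattice of mesh d with corner -1 - i. The real parts may move by d/4: room
    to dodge earlier discs, while distinct points stay d/2 apart. *)
Definition near_lattice (d : R) (b : nat -> nat -> C) := forall i k,
  `|complex.Re (b i k) - ((i%:R + 1 / 2) * d - 1)| <= d / 4 /\
  complex.Im (b i k) = (k%:R + 1 / 2) * d - 1.

Lemma near_lattice_sep d b i k j l : 0 < d -> near_lattice d b ->
  (i, k) != (j, l) -> d / 2 <= normc (b i k - b j l).
Proof.
move=> d0 bP; rewrite xpair_eqE negb_and => /orP ne.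
have [ei ek] := bP i k; have [ej el] := bP j l.
have [kl|kl] := eqVneq k l; last first.
  apply: le_trans (Im_le_normc _); rewrite raddfB /= ek el.
  have -> : (k%:R + 1 / 2) * d - 1 - ((l%:R + 1 / 2) * d - 1) = (k%:R - l%:R) * d.
    by ring.
  rewrite normrM (gtr0_norm d0); have := ler1_distn R kl; nra.
case: ne => [ij|]; last by rewrite kl eqxx.
apply: le_trans (Re_le_normc _); rewrite raddfB /=.
have := ler1_distn R ij => h.
have h2 : d <= `|(i%:R - j%:R) * d| by rewrite normrM (gtr0_norm d0); nra.
move: ei ej; rewrite !ler_norml => /andP[? ?] /andP[? ?].
move: h2; rewrite ler_normr => /orP[h2|h2].
  by rewrite ler_normr; apply/orP; left; lra.
by rewrite ler_normr; apply/orP; right; lra.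
Qed.

(** For radius eps d^2 and candidate spacing q d, the condition of [exists_avoiding_point] reads 9
    eps < q^2, free of d. So eps depends on the number of earlier discs but not on L. *)
Lemma exists_avoiding_lattice H (L : nat) (eps : R) : good_discs H ->
  (0 < L)%N -> 0 < eps -> 9 * eps * (4 * (size H)%:R + 4) ^+ 2 < 1 ->
  exists2 b, near_lattice L%:R^-1 b &
    forall i k, avoids H (eps / L%:R ^+ 2) (b i k).
Proof.
move=> gH L0 e0 eH; set d : R := L%:R^-1; set m := size H in eH *.
have l1 : 1 <= L%:R :> R by rewrite ler1n.
have d0 : 0 < d by rewrite invr_gt0; lra.
have d1 : d <= 1 by rewrite invf_le1//; lra.
have m0 : 0 <= m%:R :> R by [].
pose q : R := (4 * m%:R + 4)^-1.
have q0 : 0 < q by rewrite invr_gt0; lra.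
have qm : q * (4 * m%:R + 4) = 1 by rewrite mulVf// gt_eqF//; lra.
have eq1 : 9 * eps < q ^+ 2.
  have qm2 : q ^+ 2 * (4 * m%:R + 4) ^+ 2 = 1 by rewrite -exprMn qm expr1n.
  have -> : 9 * eps = q ^+ 2 * (9 * eps * (4 * m%:R + 4) ^+ 2).
    by rewrite mulrCA qm2 mulr1.
  by rewrite -[ltRHS]mulr1 ltr_pM2l ?exprn_gt0.
have rE : eps / L%:R ^+ 2 = eps * d ^+ 2 by rewrite exprVn.
have q1 : q ^+ 2 <= 1.
  by rewrite expr_le1 ?(ltW q0)// invf_le1; lra.
have e1 : eps <= 1 by lra.
have d21 : d ^+ 2 <= 1 by rewrite expr_le1 ?(ltW d0).
have d20 : 0 < d ^+ 2 by rewrite exprn_gt0.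
have H' (p : C) : exists t, (t <= 2 * m)%N /\
    avoids H (eps / L%:R ^+ 2) (p + (q * d * t%:R)%:C).
  have [|||t tm tH] := @exists_avoiding_point _ H p (q * d) (eps / L%:R ^+ 2) gH.
  - by rewrite rE; nra.
  - by rewrite rE; nra.
  - by rewrite rE exprMn mulrA ltr_pM2r.
  by exists t.
(* The candidates start a quarter of a cell from its left side and spread over at most half its
   width, since 2 m q <= 1/2; they stay within d/4 of the centre. *)
pose p (i k : nat) : C := ((i%:R + 1 / 4) * d - 1) +i* ((k%:R + 1 / 2) * d - 1).
have /choice[t tP] : forall ik : nat * nat, exists t, (t <= 2 * m)%N /\
    avoids H (eps / L%:R ^+ 2) (p ik.1 ik.2 + (q * d * t%:R)%:C).
  by move=> ik; exact: H'.
exists (fun i k => p i k + (q * d * (t (i, k))%:R)%:C); last first.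
  by move=> i k; have [] := tP (i, k).
move=> i k; have [tm _] := tP (i, k); split; last by rewrite /= addr0.
rewrite [complex.Re _]/=.
have -> : (i%:R + 1 / 4) * d - 1 + q * d * (t (i, k))%:R -
  ((i%:R + 1 / 2) * d - 1) = (q * (t (i, k))%:R - 1 / 4) * d by field.
have qt0 : 0 <= q * (t (i, k))%:R by rewrite mulr_ge0// ltW.
have qt1 : q * (t (i, k))%:R <= 1 / 2.
  have : (t (i, k))%:R <= 2 * m%:R :> R by rewrite -natrM ler_nat.
  nra.
rewrite normrM (gtr0_norm d0) [leRHS]mulrC ler_wpM2r ?(ltW d0)//.
by rewrite ler_norml; apply/andP; split; lra.
Qed.

Lemma harmonic_unbounded (M : R) : exists T, M <= \sum_(i < T) i.+1%:R^-1.
Proof.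
apply: contrapT => /forallNP H; apply: (@dvg_harmonic R).
apply: nondecreasing_is_cvgn.
  by apply: nondecreasing_series => i _ _; rewrite /= invr_ge0.
exists M => _ [T _ <-]; rewrite /series /= big_mkord ltW// ltNge.
by apply/negP => /H.
Qed.

(** Row i has i + 1 terms with k <= i, each at least 1 / (2 (i + 1)^2). *)
Lemma inverse_square_lattice_sum (T : nat) :
  (\sum_(i < T) i.+1%:R^-1) / 2 <=
  \sum_(i < T) \sum_(k < T) (i.+1%:R ^+ 2 + k.+1%:R ^+ 2)^-1 :> R.
Proof.
rewrite mulr_suml; apply: ler_sum => i _.
rewrite (bigID (fun k : 'I_T => (k < i.+1)%N)) /=.
have i0 : 0 < i.+1%:R :> R by rewrite ltr0n.
apply: (@le_trans _ _ (\sum_(k < T | (k < i.+1)%N) (2 * i.+1%:R ^+ 2)^-1)); last first.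
  rewrite -[leLHS]addr0 lerD//; last first.
    by apply: sumr_ge0 => k _; rewrite invr_ge0 addr_ge0 ?sqr_ge0.
  apply: ler_sum => k ki; rewrite lef_pV2 ?posrE.
  - rewrite mulrDl mul1r lerD2l lerXn2r ?nnegrE ?ler0n// ler_nat//.
  - by rewrite mulr_gt0// exprn_gt0.
  - by rewrite addr_gt0// exprn_gt0// ltr0n.
rewrite -(big_ord_widen T (fun=> (2 * i.+1%:R ^+ 2)^-1) (ltn_ord i)).
rewrite sumr_const card_ord.
rewrite -[leRHS]mulr_natl.
have -> : i.+1%:R * (2 * i.+1%:R ^+ 2)^-1 = i.+1%:R^-1 / 2 :> R.
  by field; rewrite gt_eqF.
by [].
Qed.

End swiss_cheese.

(** Meant for sums of c / (z - b): every pole contributes at most d, except for one pole near z,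
    which may contribute 1 more. *)
Lemma sum_one_exception (R : realType) (T : eqType) (s : seq T) (F : T -> R)
    (bad : pred T) (d : R) : uniq s ->
  {in s, forall x, F x <= d + (bad x)%:R} ->
  {in s &, forall x y, bad x -> bad y -> x = y} ->
  \sum_(x <- s) F x <= d * (size s)%:R + 1.
Proof.
move=> us Fd badU.
apply: (@le_trans _ _ (\sum_(x <- s) (d + (bad x)%:R))).
  by rewrite big_seq [leRHS]big_seq; apply: ler_sum.
rewrite big_split /= big_const_seq count_predT iter_addr_0 mulr_natr lerD2l.
rewrite -natr_sum lern1.
have -> : (\sum_(x <- s) bad x)%N = size (seq.filter bad s).
  rewrite size_filter -sum1_count [RHS]big_mkcond; apply: eq_bigr => x _.
  by case: (bad x).
have := filter_uniq bad us.
have bP x : x \in seq.filter bad s -> (x \in s) && bad x.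
  by rewrite mem_filter andbC.
case: (seq.filter bad s) bP => [//|x [//|y t]] bP /=.
have /andP[xs bx] := bP x (mem_head _ _).
have /andP[ys b_y] : (y \in s) && bad y by apply: bP; rewrite !inE eqxx orbT.
by rewrite !inE (badU x y)// eqxx.
Qed.

Section swiss_cheese.
Variable R : realType.
Local Notation C := R[i].
Implicit Types (D : C * R) (H : seq (C * R)).

(** * One stage of the construction *)

Section stage.
Variables (H : seq (C * R)) (L N : nat) (eps : R) (b : nat -> nat -> C).
Hypotheses (gH : good_discs H) (L0 : (0 < L)%N) (N0 : (0 < N)%N).
Hypotheses (eps0 : 0 < eps) (eps1 : eps < 1 / 8).
Let d : R := L%:R^-1.
Let rho : R := eps * d ^+ 2.
Hypotheses (bL : near_lattice d b) (bH : forall i k, avoids H rho (b i k)).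

Let d0 : 0 < d. Proof. by rewrite invr_gt0 ltr0n. Qed.
Let d1 : d <= 1. Proof. by rewrite invf_le1 ?ltr0n// ler1n. Qed.
Let rho0 : 0 < rho. Proof. by rewrite mulr_gt0// exprn_gt0. Qed.
Let rhod : rho <= eps * d.
Proof. by rewrite /rho expr2 mulrA ler_piMr// mulr_ge0// ltW. Qed.

(* By [avoids], a disc of the lattice that is dropped although it is far from
   the unit circle lies inside a disc of H. *)
Definition stage_keep (ik : nat * nat) :=
  (normc (b ik.1 ik.2) + rho <= 1 - N%:R^-1) &&
  all (fun D => D.2 + rho < normc (b ik.1 ik.2 - D.1)) H.

Definition stage_cells := [seq (i, k) | i <- iota 0 (2 * L), k <- iota 0 (2 * L)].

Definition stage_discs := [seq (b ik.1 ik.2, rho) | ik <- stage_cells & stage_keep ik].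

Definition stage := H ++ stage_discs.

Lemma uniq_cells m n p q : uniq [seq (i, k) | i <- iota m n, k <- iota p q].
Proof.
apply: allpairs_uniq; [exact: iota_uniq | exact: iota_uniq|].
by move=> [? ?] [? ?] _ _ /=.
Qed.

Lemma good_stage : good_discs stage.
Proof.
have /andP[dH aH] := gH.
have N1 : 0 < N%:R^-1 :> R by rewrite invr_gt0 ltr0n.
apply/andP; split; last first.
  rewrite all_cat aH /=; apply/allP => _ /mapP[ik + ->].
  rewrite mem_filter => /andP[/andP[kb _] _].
  by rewrite /disc_in_disc /= rho0 /=; lra.
rewrite /disjoint_discs pairwise_cat -/(disjoint_discs H) dH /=; apply/andP; split.
  apply/allrelP => D _ DH /mapP[ik + ->].
  by rewrite mem_filter => /andP[/andP[_ /allP/(_ D DH) h] _] /=; rewrite normcB.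
rewrite pairwise_map; apply: uniq_pairwise.
  by apply: filter_uniq; exact: uniq_cells.
move=> [i k] [j l] _ _ ne /=.
apply: lt_le_trans (near_lattice_sep d0 bL ne).
have : eps * d < 1 / 8 * d by rewrite ltr_pM2r.
have := rhod; have := d0; lra.
Qed.

Lemma stage_sub : {subset H <= stage}.
Proof. by move=> D DH; rewrite mem_cat DH. Qed.

(** There are at most (2 L)^2 new discs of radius eps / L^2, each at distance at least 1/N from the
    unit circle: L cancels. *)
Lemma weight_stage : disc_weight stage <= disc_weight H + 4 * eps * N%:R ^+ 2.
Proof.
rewrite /disc_weight big_cat lerD2l /= big_map.
have n0 : 0 < N%:R :> R by rewrite ltr0n.
apply: (@le_trans _ _ (\sum_(ik <- stage_cells) rho * N%:R ^+ 2)).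
  rewrite big_filter; rewrite [leRHS](bigID stage_keep) /= -[leLHS]addr0.
  rewrite lerD//; last first.
    by apply: sumr_ge0 => ik _; rewrite mulr_ge0 ?sqr_ge0// ltW.
  apply: ler_sum => ik /andP[kb _].
  have N1 : 0 < N%:R^-1 :> R by rewrite invr_gt0.
  have x0 : N%:R^-1 <= 1 - normc (b ik.1 ik.2) - rho by lra.
  rewrite /= ler_pdivrMr; last by rewrite exprn_gt0// (lt_le_trans N1).
  rewrite -mulrA ler_peMr ?(ltW rho0)// -exprMn exprn_ege1//.
  by rewrite -[leLHS](divff (lt0r_neq0 n0)) ler_pM2l.
rewrite big_const_seq count_predT iter_addr_0 /stage_cells size_allpairs !size_iota.
rewrite -[leLHS]mulr_natr !natrM /rho.
have -> : eps * d ^+ 2 * N%:R ^+ 2 * (2 * L%:R * (2 * L%:R)) =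
  4 * eps * N%:R ^+ 2 * (d * L%:R) ^+ 2 by ring.
by rewrite mulVf ?expr1n ?mulr1// pnatr_eq0 -lt0n.
Qed.

(** Either the disc about [b i k] is kept, or [b i k] lies in a disc of H with margin rho; both ways
    the whole disc of radius rho about it is removed. *)
Lemma stage_pole i k : (i < 2 * L)%N -> (k < 2 * L)%N ->
  normc (b i k) + rho <= 1 - N%:R^-1 ->
  in_discs stage (b i k) /\
  forall z, ~ in_discs stage z -> rho <= normc (z - b i k).
Proof.
move=> iL kL bN.
have [/allP ka|] := boolP (all (fun D => D.2 + rho < normc (b i k - D.1)) H).
  have mem : (b i k, rho) \in stage.
    rewrite mem_cat; apply/orP; right; apply/mapP; exists (i, k) => //.
    rewrite mem_filter /stage_keep /= bN /=; apply/andP; split; first exact/allP.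
    by rewrite allpairs_f// mem_iota.
  split; first by exists (b i k, rho) => //=; rewrite subrr normc0.
  by move=> z zs; rewrite leNgt; apply/negP => h; apply: zs; exists (b i k, rho).
case/allPn => D DH; case: (bH i k DH) => [inD _|-> //].
split; first by exists D; [exact: stage_sub | have := rho0; lra].
move=> z zs; rewrite leNgt; apply/negP => h; apply: zs; exists D; first exact: stage_sub.
by have := le_normcD (z - b i k) (b i k - D.1); rewrite addrA subrK; lra.
Qed.

(** * The test function of a stage *)

Section test_function.
Variables (a : C) (T : nat).
Hypotheses (aN : normc a <= 1 - 2 * N%:R^-1).
Hypotheses (TL : (4 * N * T.+1 ^ 2 <= L)%N).

(** The cell (i0, k0) contains a; the poles come from the T by T block of cells that starts there
    and extends up and to the right. *)
Let i0 := Num.truncn ((complex.Re a + 1) * L%:R).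
Let k0 := Num.truncn ((complex.Im a + 1) * L%:R).

Let a1 : normc a <= 1.
Proof.
have : 0 <= N%:R^-1 :> R by rewrite invr_ge0.
by move: aN; lra.
Qed.

Let trunc_itv (x : R) : `|x| <= normc a ->
  (Num.truncn ((x + 1) * L%:R))%:R * d <= x + 1 <
  (Num.truncn ((x + 1) * L%:R))%:R * d + d.
Proof.
move=> xa; have l0 : 0 < L%:R :> R by rewrite ltr0n.
have x1 : 0 <= (x + 1) * L%:R.
  by rewrite mulr_ge0//; move: (le_trans xa a1); rewrite ler_norml; lra.
have /andP[h1 h2] := truncn_itv x1.
have Xd : (x + 1) * L%:R * d = x + 1 by rewrite mulfK// gt_eqF.
move: h1 h2; rewrite -natr1; move: (Num.truncn _)%:R => t h1 h2.
rewrite -Xd; apply/andP; split; first by rewrite ler_pM2r.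
by rewrite -[X in _ < _ + X]mul1r -mulrDl ltr_pM2r.
Qed.

Let re_itv := trunc_itv (Re_le_normc a).
Let im_itv := trunc_itv (Im_le_normc a).

(** This makes the block fit between |a| and 1 - 1/N, and the T^2 far terms of the test function add
    up to at most 1. *)
Let Td : 4 * T.+1%:R ^+ 2 * d <= N%:R^-1.
Proof.
have l0 : 0 < L%:R :> R by rewrite ltr0n.
have n0 : 0 < N%:R :> R by rewrite ltr0n.
rewrite ler_pdivrMr// [leRHS]mulrC ler_pdivlMr//.
rewrite -!natrX -!natrM ler_nat; by apply: leq_trans TL; rewrite mulnAC.
Qed.

Let N1 : N%:R^-1 <= 1 :> R.
Proof. by rewrite invf_le1 ?ltr0n// ler1n. Qed.

Let T1 : 4 * T.+1%:R * d <= N%:R^-1.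
Proof.
apply: le_trans Td; rewrite ler_pM2r// ler_pM2l// expr2 ler_peMr// ler1n//.
Qed.

Lemma test_dist i k :
  `|complex.Re (a - b (i0 + i)%N (k0 + k)%N)| <= i.+1%:R * d /\
  `|complex.Im (a - b (i0 + i)%N (k0 + k)%N)| <= k.+1%:R * d.
Proof.
have [re im] := bL (i0 + i)%N (k0 + k)%N; rewrite !raddfB /= im.
move: re; rewrite !natrD -(natr1 i) -(natr1 k) !ler_norml => /andP[re1 re2].
have [/andP[ra1 ra2] /andP[ia1 ia2]] := (re_itv, im_itv).
have i_d : 0 <= i%:R * d by rewrite mulr_ge0// ltW.
have k_d : 0 <= k%:R * d by rewrite mulr_ge0// ltW.
have dd := d0.
move: re1 re2 ra1 ra2 ia1 ia2; rewrite -/i0 -/k0.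
move: (i0%:R) (k0%:R) => t u *.
by split; apply/andP; split; lra.
Qed.

Lemma test_region i k : (i < T)%N -> (k < T)%N ->
  normc (b (i0 + i)%N (k0 + k)%N) + rho <= 1 - N%:R^-1.
Proof.
move=> iT kT; have [re im] := test_dist i k.
have := normc_le_ReIm (a - b (i0 + i)%N (k0 + k)%N).
have := ler_dist_normc (b (i0 + i)%N (k0 + k)%N) a; rewrite normcB => h1 h2.
have i1 : i.+1%:R * d <= T%:R * d by rewrite ler_pM2r// ler_nat.
have k1 : k.+1%:R * d <= T%:R * d by rewrite ler_pM2r// ler_nat.
have ed : eps * d <= 1 / 8 * d by rewrite ler_pM2r// ltW.
have t0 : 0 <= T%:R * d by rewrite mulr_ge0// ltW.
have := T1; rewrite -natr1; have := rhod; have := aN; have := d0; lra.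
Qed.

Lemma test_index i k : (i < T)%N -> (k < T)%N ->
  (i0 + i < 2 * L)%N /\ (k0 + k < 2 * L)%N.
Proof.
move=> iT kT; have l0 : 0 < L%:R :> R by rewrite ltr0n.
have Ld : L%:R * d = 1 by rewrite mulfV// gt_eqF.
have i1 : i%:R * d <= T%:R * d by rewrite ler_pM2r// ler_nat ltnW.
have k1 : k%:R * d <= T%:R * d by rewrite ler_pM2r// ler_nat ltnW.
have [/andP[ra1 _] /andP[ia1 _]] := (re_itv, im_itv).
have ra2 : complex.Re a <= normc a by exact: le_trans (ler_norm _) (Re_le_normc a).
have ia2 : complex.Im a <= normc a by exact: le_trans (ler_norm _) (Im_le_normc a).
have t0 : 0 <= T%:R * d by rewrite mulr_ge0// ltW.
have n0 : 0 < N%:R^-1 :> R by rewrite invr_gt0 ltr0n.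
have tn : 2 * (T%:R * d) <= N%:R^-1 by have := T1; rewrite -natr1; have := d0; lra.
have an := aN.
split; rewrite -(ltr_nat R) -(ltr_pM2r d0) natrM -mulrA Ld natrD mulrDl.
  by move: ra1; rewrite -/i0; lra.
by move: ia1; rewrite -/k0; lra.
Qed.

Let cells := [seq (i, k) | i <- iota 0 T, k <- iota 0 T].
Let pole (ik : nat * nat) : C := b (i0 + ik.1)%N (k0 + ik.2)%N.
(* The phases make all the terms of the derivative at a positive. *)
Let coef (ik : nat * nat) : C :=
  rho%:C * ((a - pole ik) ^+ 2 / (normc (a - pole ik) ^+ 2)%:C).
Let test := [seq (coef ik, pole ik) | ik <- cells].

Let cellsP ik : ik \in cells -> in_discs stage (pole ik) /\
  forall z, ~ in_discs stage z -> rho <= normc (z - pole ik).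
Proof.
move=> /allpairsP[[i k] /= [+ + ->]]; rewrite !mem_iota /= => iT kT.
by have [? ?] := test_index iT kT; apply: stage_pole => //; exact: test_region.
Qed.

Let normc_coef ik : normc (coef ik) <= rho.
Proof.
rewrite normcM normc_real gtr0_norm// ler_piMr ?(ltW rho0)//.
rewrite normcM normcV normc_real normcX ger0_norm ?sqr_ge0//.
have [->|n0] := eqVneq (normc (a - pole ik)) 0; first by rewrite expr0n mul0r.
by rewrite divff// expf_neq0.
Qed.

(** A pole at distance at least d/4 contributes at most 4 eps d, and all of these together at most
    1. As the poles are d/2 apart, at most one is nearer to z, and its term is at most 1 since |c|
    <= rho <= |z - b|. *)
Lemma test_bounded z : ~ in_discs stage z ->
  normc (\sum_(p <- test) p.1 / (z - p.2)) <= 2.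
Proof.
move=> zs; rewrite big_map (le_trans (le_normc_sum _ _ _))//=.
apply: (@le_trans _ _ (4 * eps * d * (size cells)%:R + 1)).
  apply: (@sum_one_exception _ _ _ _ (fun ik => normc (z - pole ik) < d / 4)).
  - exact: uniq_cells.
  - move=> ik /cellsP[_ /(_ z zs) zp].
    have z0 : 0 < normc (z - pole ik) by exact: lt_le_trans zp.
    rewrite normcM normcV ler_pdivrMr// (le_trans (normc_coef _))//.
    case: ltP => [_|zd].
      by rewrite mulrDl mul1r (le_trans zp)// lerDr !mulr_ge0 ?ltW.
    rewrite addr0; have : 4 * eps * d * (d / 4) <= 4 * eps * d * normc (z - pole ik).
      by rewrite ler_pM2l// !mulr_gt0.
    by apply: le_trans; rewrite /rho; lra.
  - move=> [i k] [j l] _ _ /= zi zj; apply/eqP; apply: contraT => ne.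
    have ne' : (i0 + i, k0 + k)%N != (i0 + j, k0 + l)%N.
      by apply: contra ne; rewrite !xpair_eqE !eqn_add2l.
    have := near_lattice_sep d0 bL ne'.
    have := le_normcD (pole (i, k) - z) (z - pole (j, l)).
    rewrite addrA subrK (normcB _ z) /pole /=; move: zi zj; rewrite /pole /=; lra.
rewrite size_allpairs !size_iota natrM.
have t0 : 0 <= T%:R :> R by [].
have -> : 4 * eps * d * (T%:R * T%:R) = 4 * (eps * (d * (T%:R * T%:R))) by ring.
have w1 : 4 * (d * (T%:R * T%:R)) <= 1.
  by have := Td; rewrite -natr1; have := d0; have := N1; nra.
have w0 : 0 <= d * (T%:R * T%:R) by rewrite !mulr_ge0// ltW.
have := ler_wpM2r w0 (ltW eps1); lra.
Qed.

(** Thanks to the phases each term equals rho / |a - b|^2, which by [test_dist] is at least eps /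
    ((i + 1)^2 + (k + 1)^2): the mesh cancels and the lattice sum remains. *)
Lemma test_derivative : ~ in_discs stage a ->
  eps * (\sum_(i < T) i.+1%:R^-1) / 2 <=
  normc (\sum_(p <- test) p.1 / (a - p.2) ^+ 2).
Proof.
move=> as_; rewrite big_map /=.
have -> : \sum_(ik <- cells) coef ik / (a - pole ik) ^+ 2 =
   (\sum_(ik <- cells) rho / normc (a - pole ik) ^+ 2)%:C.
  rewrite raddf_sum /= big_seq [RHS]big_seq; apply: eq_bigr => ik /cellsP[_ /(_ _ as_) ap].
  have a0 : a - pole ik != 0 by rewrite -normc_gt0 (lt_le_trans rho0).
  have n0 : (normc (a - pole ik) ^+ 2)%:C != 0 :> C.
    by rewrite fmorph_eq0 expf_neq0// normc_eq0.
  have -> : (rho / normc (a - pole ik) ^+ 2)%:C =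
      rho%:C / (normc (a - pole ik) ^+ 2)%:C :> C.
    by rewrite -fmorphV -rmorphM.
  have fieldE (r u w : C) : u != 0 -> w != 0 -> r * (w ^+ 2 / u) / w ^+ 2 = r / u.
    by move=> u0 w0; field; rewrite u0 w0.
  exact: fieldE.
rewrite normc_real.
apply: le_trans (ler_norm _).
rewrite big_allpairs_dep /=.
apply: (@le_trans _ _ (\sum_(i < T) \sum_(k < T) eps * (i.+1%:R ^+ 2 + k.+1%:R ^+ 2)^-1)).
  under [leRHS]eq_bigr do rewrite -mulr_sumr.
  rewrite -mulr_sumr -mulrA ler_pM2l//; exact: inverse_square_lattice_sum.
have iE (F : nat -> R) : \sum_(i <- iota 0 T) F i = \sum_(i < T) F i.
  by rewrite -(big_mkord xpredT F) /index_iota subn0.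
rewrite iE; apply: ler_sum => i _; rewrite iE; apply: ler_sum => k _.
have ik : (val i, val k) \in cells by apply: allpairs_f; rewrite mem_iota /=.
have [_ /(_ _ as_) ap] := cellsP ik.
have n0 : 0 < normc (a - pole (val i, val k)) by exact: lt_le_trans ap.
have [re im] := test_dist i k.
have s0 : 0 < i.+1%:R ^+ 2 + k.+1%:R ^+ 2 :> R by rewrite addr_gt0// exprn_gt0// ltr0n.
rewrite ler_pdivlMr ?exprn_gt0// mulrAC ler_pdivrMr// -mulrA ler_pM2l//.
rewrite normcE mulrDr (mulrC (d ^+ 2)) (mulrC (d ^+ 2)) -!exprMn.
have id0 : 0 <= i.+1%:R * d by rewrite mulr_ge0// ltW.
have kd0 : 0 <= k.+1%:R * d by rewrite mulr_ge0// ltW.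
rewrite -(real_normK (num_real (complex.Re _))) -(real_normK (num_real (complex.Im _))).
by rewrite lerD// lerXn2r ?nnegrE.
Qed.

Lemma test_poles p : p \in test -> in_discs stage p.2.
Proof. by move=> /mapP[ik /cellsP[h _] ->]. Qed.

Lemma stage_test_function : exists s : seq (C * C),
  [/\ forall p, p \in s -> in_discs stage p.2,
     forall z, ~ in_discs stage z -> normc (\sum_(p <- s) p.1 / (z - p.2)) <= 2 &
     ~ in_discs stage a -> eps * (\sum_(i < T) i.+1%:R^-1) / 2 <=
       normc (\sum_(p <- s) p.1 / (a - p.2) ^+ 2)].
Proof.
by exists test; split; [exact: test_poles | exact: test_bounded |
  exact: test_derivative].
Qed.

End test_function.
End stage.
End swiss_cheese.

(** * The sequence of stages *)

Section swiss_cheese.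
Variable R : realType.
Local Notation C := R[i].
Implicit Types D : C * R.

(** The last sum is minus the derivative at a of the function bounded by 2. *)
Definition has_test_function (H : seq (C * R)) n (a : C) := exists s : seq (C * C),
  [/\ forall p, p \in s -> in_discs H p.2,
     forall z, ~ in_discs H z -> normc (\sum_(p <- s) p.1 / (z - p.2)) <= 2 &
     ~ in_discs H a -> n%:R <= normc (\sum_(p <- s) p.1 / (a - p.2) ^+ 2)].

Lemma next_stage (H : seq (C * R)) n : good_discs H -> exists H',
  [/\ good_discs H', {subset H <= H'},
     disc_weight H' <= disc_weight H + (1 / 2) ^+ n &
     forall a, normc a <= 1 - 2 * n.+2%:R^-1 -> has_test_function H' n a].
Proof.
move=> gH; pose N := n.+2; pose Y : R := (4 * (size H)%:R + 4) ^+ 2.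
(* Y is the quantity in the condition of [exists_avoiding_lattice], Z keeps the added weight 4 eps
   N^2 below 2^-n, and 16 is slack. *)
pose Z : R := N%:R ^+ 2; pose eps := (1 / 2) ^+ n / (16 * Y * Z).
have Y16 : 16 <= Y.
  have : 0 <= (size H)%:R :> R by [].
  by rewrite /Y; nra.
have Z4 : 4 <= Z.
  have : 2 <= N%:R :> R by rewrite ler_nat.
  by rewrite /Z; nra.
have h0 : 0 < (1 / 2) ^+ n :> R by rewrite exprn_gt0//; lra.
have h1 : (1 / 2) ^+ n <= 1 :> R by rewrite exprn_ile1//; lra.
have YZ : 0 < 16 * Y * Z by rewrite !mulr_gt0//; lra.
have eps0 : 0 < eps by rewrite divr_gt0.
have epsE : eps * (16 * Y * Z) = (1 / 2) ^+ n by rewrite mulfVK ?gt_eqF.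
have YZ' : 16 * Y <= 16 * Y * Z by rewrite ler_peMr; lra.
have ZY' : 256 * Z <= 16 * Y * Z by rewrite ler_wpM2r; lra.
have e1 : 16 * (eps * Y) <= 1.
  by have := ler_wpM2l (ltW eps0) YZ'; lra.
have e2 : 256 * (eps * Z) <= (1 / 2) ^+ n.
  by have := ler_wpM2l (ltW eps0) ZY'; lra.
have e3 : eps < 1 / 8.
  by have := ler_wpM2l (ltW eps0) Y16; lra.
have e4 : 9 * eps * Y < 1.
  have : 0 < eps * Y by rewrite mulr_gt0//; lra.
  lra.
have [T hT] := harmonic_unbounded (2 * n%:R / eps).
(* L comes last, after eps and T, because the bound on the weight does not involve it. *)
pose L := (4 * N * T.+1 ^ 2)%N.
have L0 : (0 < L)%N by rewrite !muln_gt0.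
have [b bL bH] := exists_avoiding_lattice gH L0 eps0 e4.
have bH' i k : avoids H (eps * L%:R^-1 ^+ 2) (b i k) by rewrite exprVn; exact: bH.
exists (stage H L N eps b); split.
- exact: good_stage.
- exact: stage_sub.
- apply: (le_trans (weight_stage _ _ _ _ _)) => //.
  rewrite lerD2l; have : 0 < eps * Z by rewrite mulr_gt0//; lra.
  rewrite -/Z; lra.
move=> a aN.
have [s [sP sB sD]] := stage_test_function L0 (isT : (0 < N)%N) eps0 e3 bL bH' aN (leqnn L).
exists s; split => // /sD; apply: le_trans.
by move: hT; rewrite ler_pdivrMr//; lra.
Qed.

(** The weight 3 is made of at most 1 for the disc about 0 and of the sum 2 of the 2^-n. The radii 1
    - 2/(n+2) exhaust the open disc. *)
Definition stages_spec (H : nat -> seq (C * R)) :=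
  [/\ forall n, good_discs (H n),
      forall n, {subset H n <= H n.+1},
      forall n, disc_weight (H n) <= 3,
      (0, 1 / 4) \in H 0%N &
      forall n a, normc a <= 1 - 2 * n.+2%:R^-1 -> has_test_function (H n.+1) n a].

Lemma exists_stages : exists H, stages_spec H.
Proof.
pose H0 : seq (C * R) := [:: (0, 1 / 4)].
have gH0 : good_discs H0.
  apply/andP; split=> //; apply/allP => D; rewrite inE => /eqP->.
  by rewrite /disc_in_disc /fst /snd normc0; lra.
have next (nH : nat * {H | good_discs H}) : exists H' : {H | good_discs H},
    [/\ {subset val nH.2 <= val H'},
     disc_weight (val H') <= disc_weight (val nH.2) + (1 / 2) ^+ nH.1 &
     forall a, normc a <= 1 - 2 * nH.1.+2%:R^-1 -> has_test_function (val H') nH.1 a].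
  case: nH => n [H gH] /=; have [H' [gH' sH wH tH]] := next_stage n gH.
  by exists (exist _ H' gH').
have [f fP] := choice next.
pose fix G n : {H | good_discs H} :=
  if n is m.+1 then f (m, G m) else exist _ H0 gH0.
exists (fun n => val (G n)); split.
- by move=> n; exact: valP.
- by move=> n; have [] := fP (n, G n).
- suff : forall n, disc_weight (val (G n)) <= 3 - 2 * (1 / 2) ^+ n.
    move=> h n; apply: (le_trans (h n)).
    have : 0 < (1 / 2) ^+ n :> R by rewrite exprn_gt0//; lra.
    lra.
  elim=> [|n IH].
    by rewrite expr0 /= /disc_weight big_seq1 /fst /snd normc0 ler_pdivrMr; lra.
  have [_ h _] := fP (n, G n).
  apply: (le_trans h) => /=; move: IH; rewrite exprS; lra.
- by rewrite inE eqxx.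
- by move=> n; have [] := fP (n, G n).
Qed.

(** * The limit set *)

Section cheese.
Variable H : nat -> seq (C * R).
Hypothesis HP : stages_spec H.

Definition cheese : set C :=
  [set z | normc z <= 1 /\ forall n, ~ in_discs (H n) z].

Lemma stages_sub m n : (m <= n)%N -> {subset H m <= H n}.
Proof.
case: HP => _ sH _ _ _ /subnKC <-; elim: (n - m)%N => [|k IH] D; first by rewrite addn0.
by move=> /IH; rewrite addnS; exact: sH.
Qed.

Lemma in_discs_sub m n a : (m <= n)%N -> in_discs (H m) a -> in_discs (H n) a.
Proof. by move=> mn [D DH aD]; exists D => //; exact: stages_sub DH. Qed.

Lemma disc_stages n D : D \in H n -> 0 < D.2 /\ normc D.1 + D.2 < 1.
Proof. by case: HP => /(_ n)/andP[_ /allP aH] _ _ _ _ /aH/andP. Qed.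

Lemma in_discs_lt1 n a : in_discs (H n) a -> normc a < 1.
Proof.
move=> [D DH aD]; have [_] := disc_stages DH.
by have := le_normcD (a - D.1) D.1; rewrite subrK; lra.
Qed.

(** A bounding circle meets no other removed disc, as the closed discs are disjoint. So bounds on X
    hold on the boundary of every finite stage. *)
Lemma boundary_cheese n z : discs_boundary (H n) z -> cheese z.
Proof.
move=> [z1|[D DH zD]].
  split=> [|m /in_discs_lt1]; first by rewrite z1.
  by rewrite z1 ltxx.
have [D0 D1] := disc_stages DH; split.
  by have := le_normcD (z - D.1) D.1; rewrite subrK; lra.
move=> m [E EH zE].
have DM := stages_sub (leq_maxl n m) DH.
have EM := stages_sub (leq_maxr n m) EH.
have [DE|DE] := eqVneq D E; first by move: zE; rewrite -DE zD ltxx.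
have [gH _ _ _ _] := HP; have [_ /(_ _ _ DM EM DE)] := good_discsP (gH (maxn n m)).
have := le_normcD (D.1 - z) (z - E.1); rewrite addrA subrK (normcB D.1 z); lra.
Qed.

Lemma pfrac_stage_mono m n (f f1 : C -> C) : (m <= n)%N ->
  pfrac (fun a => 1 < normc a \/ in_discs (H m) a) f f1 ->
  pfrac (fun a => 1 < normc a \/ in_discs (H n) a) f f1.
Proof.
move=> mn; apply: pfrac_sub => a [|am]; [by left | right].
exact: in_discs_sub am.
Qed.

(** There are finitely many poles, so one stage catches all those in the closed unit disc, and the
    infinite cheese may be replaced by a finite list of discs. *)
Lemma pfrac_stage f f1 : pfrac (fun a => ~ cheese a) f f1 ->
  exists n, pfrac (fun a => 1 < normc a \/ in_discs (H n) a) f f1.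
Proof.
elim=> [|c j u u1 _ [n IH]|c a k u u1 Pa _ [n IH]].
- by exists 0%N; exact: pfrac0.
- by exists n; exact: pfrac_mono.
have [a1|a1] := ltP 1 (normc a).
  by exists n; apply: pfrac_pole => //; left.
have [m am] : exists m, in_discs (H m) a.
  by apply: contrapT => /forallNP h; apply: Pa; split.
exists (maxn n m); apply: pfrac_pole; last exact: pfrac_stage_mono (leq_maxl n m) IH.
by right; exact: in_discs_sub (leq_maxr n m) am.
Qed.

(** The constant 6 is twice the bound 3 on the weights, which is the same for every stage. *)
Lemma cheese_pairing f f1 g g1 (F G : R) :
  ratl (fun a => ~ cheese a) f f1 -> ratl (fun a => ~ cheese a) g g1 ->
  (forall z, cheese z -> normc (f z) <= F) ->
  (forall z, cheese z -> normc (g z) <= G) ->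
  exists2 v, has_mean (fun z => z * f1 z * g z) v & normc v <= 6 * F * G.
Proof.
move=> [f' [f1' [fP fE]]] [g' [g1' [gP gE]]] fF gG.
have [n fn] := pfrac_stage fP; have [m gm] := pfrac_stage gP.
pose k := maxn n m.
have {}fn := pfrac_stage_mono (leq_maxl n m) fn.
have {}gm := pfrac_stage_mono (leq_maxr n m) gm.
have [gH _ /(_ k) wH _ _] := HP.
have F0 : 0 <= F.
  apply: le_trans (fF 1 _); first exact: normc_ge0.
  by apply: (@boundary_cheese 0); left; exact: normc1.
have G0 : 0 <= G.
  apply: le_trans (gG 1 _); first exact: normc_ge0.
  by apply: (@boundary_cheese 0); left; exact: normc1.
have notP z : cheese z -> ~ ~ cheese z by move=> ? /(_ _).
have := boundary_pairing_bound (f := f') (g := g') (F := F) (G := G) (gH k) _ _ _ _ fn gm.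
case=> //.
- by move=> z /boundary_cheese[z1 zn] [|/zn//]; rewrite ltNge z1.
- move=> z /boundary_cheese zX; have [<- _] := fE z (notP z zX); exact: fF.
- move=> z /boundary_cheese zX; have [<- _] := gE z (notP z zX); exact: gG.
move=> v vM vle; exists v.
  apply: eq_has_mean vM => z z1.
  have zX : cheese z by apply: (@boundary_cheese 0); left.
  by have [_ ->] := fE z (notP z zX); have [-> _] := gE z (notP z zX).
apply: (le_trans vle); rewrite ler_wpM2r// ler_wpM2r//; lra.
Qed.

End cheese.

End swiss_cheese.

(** * Point derivations *)

Section topology_of_C.
Variable R : realType.
Local Notation C := R[i].

Lemma nbhs_normcP (z : C) (A : set C) : nbhs z A <->
  exists2 e : R, 0 < e & forall w, normc (z - w) < e -> A w.
Proof.
split=> [/nbhs_ballP[e /= e0 eA]|[e e0 eA]].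
  exists (complex.Re e); first by rewrite -ltcR -gt0_complexE.
  by move=> w zw; apply: eA; rewrite -ball_normE /= (gt0_complexE e0) ltcR.
apply/nbhs_ballP; exists e%:C; first by rewrite /= ltcR.
by move=> w; rewrite -ball_normE /= ltcR; exact: eA.
Qed.

Lemma closed_disc_compact : compact [set z : C | normc z <= 1].
Proof.
pose f (p : R * R) : C := p.1 +i* p.2.
have fc : continuous f.
  move=> [x y] A /nbhs_normcP[e e0 eA].
  have e2 : 0 < e / 2 by lra.
  exists (ball x (e / 2), ball y (e / 2)).
    by split; exact: nbhsx_ballx.
  move=> [u v] [/= xu yv]; apply: eA.
  apply: le_lt_trans (normc_le_ReIm _) _ => /=.
  by move: xu yv; rewrite -!ball_normE /=; lra.
have : compact (f @` (`[-1, 1] `*` `[-1, 1])).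
  apply: continuous_compact; first exact: continuous_subspaceT.
  by apply: compact_setX; exact: segment_compact.
move=> fcpt; apply: (subclosed_compact _ fcpt); last first.
  move=> [x y] z1; exists (x, y) => //; split; rewrite /= in_itv /= -ler_norml.
    by have := Re_le_normc (x +i* y); move: z1; rewrite /=; lra.
  by have := Im_le_normc (x +i* y); move: z1; rewrite /=; lra.
move=> z zcl; rewrite /= leNgt; apply/negP => z1.
have /zcl[w [w1]] : nbhs z [set w | normc (z - w) < normc z - 1].
  by apply/nbhs_normcP; exists (normc z - 1); [lra | move=> w].
by have := ler_dist_normc z w; move: w1; rewrite /=; lra.
Qed.

Lemma cheese_compact (H : nat -> seq (C * R)) : compact (cheese H).
Proof.
apply: (subclosed_compact _ closed_disc_compact); last by move=> z [].
move=> z zcl; split.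
  rewrite leNgt; apply/negP => z1.
  have /zcl[w [[w1 _]]] : nbhs z [set w | normc (z - w) < normc z - 1].
    by apply/nbhs_normcP; exists (normc z - 1); [lra | move=> w].
  by have := ler_dist_normc z w; rewrite /=; lra.
move=> n [D DH zD].
have /zcl[w [[_ /(_ n) wn] /= h]] : nbhs z [set w | normc (z - w) < D.2 - normc (z - D.1)].
  by apply/nbhs_normcP; exists (D.2 - normc (z - D.1)); [lra | move=> w].
apply: wn; exists D => //.
by have := le_normcD (w - z) (z - D.1); rewrite addrA subrK normcB (normcB w); lra.
Qed.

Lemma continuous_linear_bound (V W : normedModType C) (f : {linear V -> W}) :
  continuous f -> exists2 M : R, 0 < M & forall x, `|f x| <= M%:C * `|x|.
Proof.
move=> /linear_bounded_continuous/linear_boundedP/pinfty_ex_gt0[r r0 fr].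
exists (complex.Re r); first by rewrite -ltcR -gt0_complexE.
by move=> x; rewrite -(gt0_complexE r0).
Qed.

Lemma bound_continuous_linear (V W : normedModType C) (f : {linear V -> W}) (M : R) :
  (forall x, `|f x| <= M%:C * `|x|) -> continuous f.
Proof.
move=> fM; apply/linear_bounded_continuous/linear_boundedP.
exists M%:C; split; first by rewrite complex_real.
by move=> r Mr x; apply: (le_trans (fM x)); rewrite ler_wpM2r ?(ltW Mr).
Qed.

End topology_of_C.

(** * Characters and point derivations of R(X) *)

Section point_derivations.
Variables (R : realType) (X : set R[i]) (cX : compact X).
Local Notation C := R[i].
Local Notation A := (RX cX).

Definition fraction_elt (p q : {poly C}) (hq : forall z, X z -> q.[z] != 0) : A :=
  exist _ (fun z : X => p.[set_val z] / q.[set_val z])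
    (mem_set (rational_on_RX (ex_intro _ p (ex_intro _ q (conj hq erefl))))).

Lemma fraction_eltE p q hq x :
  val (@fraction_elt p q hq) x = p.[set_val x] / q.[set_val x].
Proof. by []. Qed.

Lemma one_neq0_on z : X z -> (1 : {poly C}).[z] != 0.
Proof. by rewrite hornerE oner_eq0. Qed.

Definition poly_elt (p : {poly C}) : A := fraction_elt p one_neq0_on.

Lemma poly_eltE p x : val (poly_elt p) x = p.[set_val x].
Proof. by rewrite fraction_eltE hornerE divr1. Qed.

Lemma RX_ext (f g : A) : (forall x, val f x = val g x) -> f = g.
Proof. by move=> fg; apply/val_inj/funext. Qed.

Lemma val_bmul (f g : A) x : val (f ** g) x = val f x * val g x.
Proof. by []. Qed.

Lemma val_bone x : val (bone : A) x = 1.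
Proof. by []. Qed.

Lemma val_addA (f g : A) x : val (f + g) x = val f x + val g x.
Proof. by rewrite raddfD. Qed.

Lemma val_scaleA (c : C) (f : A) x : val (c *: f) x = c * val f x.
Proof. by rewrite linearZ. Qed.

Lemma val_oppA (f : A) x : val (- f) x = - val f x.
Proof. by rewrite raddfN. Qed.

Lemma RX_norm_bound (f : A) (M : R) : 0 <= M ->
  (forall x, normc (val f x) <= M) -> `|f| <= M%:C.
Proof.
move=> M0 fM; rewrite RX_normE; apply: RX_norm_le; first by rewrite ler0c.
by move=> x; rewrite lecR.
Qed.

Lemma fraction_elt_approx (f : A) (e : R) : 0 < e -> exists p q hq,
  `|f - @fraction_elt p q hq| <= e%:C.
Proof.
move=> e0; have [_ /closure_rational_onP fcl] : RX_set (val f) by exact: set_valP.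
have [|g [p [q [hq gE]]] fg] := fcl e%:C; first by rewrite ltcR.
exists p, q, hq; apply: RX_norm_bound; first exact: ltW.
move=> x; rewrite val_addA val_oppA fraction_eltE -lecR.
by have := fg x; rewrite gE => /ltW.
Qed.

Section character.
Variables (phi : {scalar A}) (phiP : character phi).
Let a := phi (poly_elt 'X).

(** Otherwise ['X - a] would be invertible in R(X), although phi vanishes on it. *)
Lemma character_eval_in : X a.
Proof.
apply: contrapT => aX.
have hq z : X z -> ('X - a%:P).[z] != 0.
  by move=> Xz; rewrite hornerXsubC subr_eq0; apply/eqP => za; apply: aX; rewrite -za.
have [phi1 phiM] := phiP.
have E : (poly_elt 'X - a *: bone) ** fraction_elt 1 hq = bone.
  apply: RX_ext => x; rewrite val_bmul val_addA val_oppA val_scaleA poly_eltE.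
  rewrite fraction_eltE !val_bone hornerX hornerXsubC hornerC mulr1 div1r divff//.
  by have := hq _ (set_valP x); rewrite hornerXsubC.
have := phiM (poly_elt 'X - a *: bone) (fraction_elt 1 hq).
rewrite E phi1 linearB linearZ /= phi1 mulr1 subrr mul0r => /eqP.
by rewrite oner_eq0.
Qed.

Lemma poly_elt_MXaddC p c : poly_elt (p * 'X + c%:P) =
  poly_elt p ** poly_elt 'X + c *: bone.
Proof.
apply: RX_ext => x; rewrite val_addA val_bmul val_scaleA !poly_eltE val_bone.
by rewrite !hornerE.
Qed.

Lemma poly_elt0 : poly_elt 0 = 0.
Proof. by apply: RX_ext => x; rewrite poly_eltE horner0 raddf0. Qed.

Lemma character_poly p : phi (poly_elt p) = p.[a].
Proof.
have [phi1 phiM] := phiP.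
elim/poly_ind: p => [|p c IH]; first by rewrite poly_elt0 linear0 horner0.
by rewrite poly_elt_MXaddC linearD linearZ /= phiM IH phi1 hornerMXaddC mulr1.
Qed.

Lemma fraction_elt_mul p q hq : poly_elt q ** @fraction_elt p q hq = poly_elt p.
Proof.
apply: RX_ext => x; rewrite val_bmul !poly_eltE fraction_eltE mulrC divfK//.
exact/hq/set_valP.
Qed.

Lemma character_fraction p q hq : phi (@fraction_elt p q hq) = p.[a] / q.[a].
Proof.
have [_ phiM] := phiP; have qa := hq _ character_eval_in.
apply: (mulfI qa); rewrite -{1}character_poly -phiM fraction_elt_mul character_poly.
by rewrite mulrC divfK.
Qed.

Variables (d : {scalar A}) (dP : point_derivation phi d).

Lemma point_derivation_one : d bone = 0.
Proof.
have [phi1 _] := phiP; have := dP bone bone.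
rewrite bmul1l phi1 !mul1r => /eqP; rewrite -subr_eq0 opprD addrA subrr sub0r.
by rewrite oppr_eq0 => /eqP.
Qed.

Lemma point_derivation_poly p : d (poly_elt p) = p^`().[a] * d (poly_elt 'X).
Proof.
elim/poly_ind: p => [|p c IH]; first by rewrite poly_elt0 linear0 deriv0 horner0 mul0r.
rewrite poly_elt_MXaddC linearD linearZ /= point_derivation_one mulr0 addr0 dP.
rewrite IH (character_poly p) -/a derivMXaddC hornerD hornerM hornerX.
rewrite [RHS]mulrDl; congr (_ + _).
by rewrite mulrA; congr (_ * _); exact: mulrC.
Qed.

Lemma point_derivation_fraction p q hq : d (@fraction_elt p q hq) =
  (p^`().[a] * q.[a] - p.[a] * q^`().[a]) / q.[a] ^+ 2 * d (poly_elt 'X).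
Proof.
have qa := hq _ character_eval_in.
move: (character_fraction p hq) (fraction_elt_mul p hq).
move: (fraction_elt p hq) => F phiF qF.
have := dP (poly_elt q) F.
rewrite qF.
rewrite (point_derivation_poly p).
rewrite (point_derivation_poly q).
rewrite (character_poly q).
rewrite phiF => h.
apply: (mulfI qa).
have -> : q.[a] * d F =
  p^`().[a] * d (poly_elt 'X) - p.[a] / q.[a] * (q^`().[a] * d (poly_elt 'X)).
  by rewrite h addrK.
move: (d (poly_elt 'X)) => dX; move: qa.
move: (p.[a]) (q.[a]) (p^`().[a]) (q^`().[a]) => pa qa pa' qa' qa0.
by field.
Qed.

(** On fractions d is a multiple of its value at ['X], by the quotient rule, and fractions are
    dense. *)
Lemma point_derivation_eq0 : continuous d -> d (poly_elt 'X) = 0 ->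
  forall f, d f = 0.
Proof.
move=> dc dX f; have [M M0 dM] := continuous_linear_bound dc.
apply/eqP; rewrite -normc_eq0 eq_le normc_ge0 andbT.
apply/ler_addgt0Pr => e e0; rewrite add0r.
have [p [q [hq fg]]] := @fraction_elt_approx f (e / M) ltac:(by rewrite divr_gt0).
have -> : d f = d (f - fraction_elt p hq).
  by rewrite linearB /= point_derivation_fraction dX mulr0 subr0.
rewrite -lecR; apply: (le_trans (dM _)).
apply: (@le_trans _ _ (M%:C * (e / M)%:C)); first by rewrite ler_wpM2l// ler0c ltW.
by rewrite -rmorphM lecR mulrC divfK// gt_eqF.
Qed.

End character.
End point_derivations.

(** * Absence of bounded point derivations *)

Section no_point_derivation.
Variables (R : realType).
Local Notation C := R[i].

Lemma point_derivation_simple_poles (X : set C) (cX : compact X)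
    (phi d : {scalar (RX cX)}) (s : seq (C * C)) :
  character phi -> point_derivation phi d -> (forall p, p \in s -> ~ X p.2) ->
  exists g : RX cX,
    (forall x, val g x = \sum_(p <- s) p.1 / (set_val x - p.2)) /\
    d g = - (\sum_(p <- s) p.1 / (phi (poly_elt cX 'X) - p.2) ^+ 2) *
          d (poly_elt cX 'X).
Proof.
move=> phiP dP; elim: s => [|p s IH] sX.
  exists 0; split=> [x|]; first by rewrite big_nil raddf0.
  by rewrite big_nil linear0 oppr0 mul0r.
have [q qs|g [gE dg]] := IH; first by apply: sX; rewrite inE qs orbT.
have hq z : X z -> ('X - (p.2)%:P).[z] != 0.
  move=> Xz; rewrite hornerXsubC subr_eq0; apply/eqP => za.
  by apply: (sX p (mem_head _ _)); rewrite -za.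
exists (p.1 *: fraction_elt cX 1 hq + g); split=> [x|].
  rewrite val_addA val_scaleA gE big_cons fraction_eltE hornerXsubC hornerC.
  by rewrite div1r.
rewrite linearD linearZ /= dg (point_derivation_fraction phiP dP).
rewrite big_cons derivC derivXsubC hornerXsubC !hornerC.
move: (d (poly_elt cX 'X)) (\sum_(j <- s) _) => dX S.
have := hq _ (character_eval_in phiP); rewrite hornerXsubC.
move: (phi _ - p.2) => w w0.
by field.
Qed.

Lemma natmul_bounded_eq0 (t M : R) (n0 : nat) : 0 <= t ->
  (forall n, (n0 <= n)%N -> n%:R * t <= M) -> t = 0.
Proof.
move=> t0 tM; apply/eqP; rewrite eq_le t0 andbT leNgt; apply/negP => tp.
have M0 : 0 <= M by apply: le_trans (tM n0 (leqnn _)); rewrite mulr_ge0.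
have := tM (maxn n0 (Num.truncn (M / t)).+1) (leq_maxl _ _).
apply/negP; rewrite -ltNge.
have h : M / t < (Num.truncn (M / t)).+1%:R by exact: truncnS_gt.
rewrite -ltr_pdivrMr//; apply: (lt_le_trans h); rewrite ler_nat; exact: leq_maxr.
Qed.

Lemma le_one_sub_inv (x : R) n : x < 1 -> (0 < n)%N -> 2 / (1 - x) <= n%:R ->
  x <= 1 - 2 * n%:R^-1.
Proof.
move=> x1 n0; rewrite ler_pdivrMr ?subr_gt0// => h.
have : 2 * n%:R^-1 <= 1 - x by rewrite ler_pdivrMr ?ltr0n// mulrC.
lra.
Qed.

Variable H : nat -> seq (C * R).
Hypothesis HP : stages_spec H.
Local Notation X := (cheese H).
Local Notation cX := (@cheese_compact R H).

Theorem cheese_no_bounded_point_derivation :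
  ~ has_nonzero_bounded_point_derivation (RX cX).
Proof.
move=> [phi [d [phiP dP dc [f]]]]; apply.
apply: (point_derivation_eq0 phiP dP dc).
have [M M0 dM] := continuous_linear_bound dc.
have Xa := character_eval_in phiP.
have dle (g : RX cX) (B : R) : 0 <= B -> (forall x, normc (val g x) <= B) ->
    normc (d g) <= M * B.
  move=> B0 gB; rewrite -lecR; apply: (le_trans (dM g)).
  rewrite rmorphM /= ler_wpM2l ?ler0c ?(ltW M0)//.
  exact: RX_norm_bound.
set a := phi (poly_elt cX 'X) in Xa *; set dX := d (poly_elt cX 'X).
apply/eqP; rewrite -normc_eq0; apply/eqP.
have [a1 _] := Xa.
have [a_eq1|a_lt1] : normc a = 1 \/ normc a < 1.
  by move: a1; rewrite le_eqVlt => /orP[/eqP|]; [left|right].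
  (* On the unit circle: z^n has norm at most 1, while its derivative at a has modulus n. *)
  apply: (@natmul_bounded_eq0 _ (M * 1) 0) => [|n _]; first exact: normc_ge0.
  have := dle (poly_elt cX 'X^n) 1 ler01.
  rewrite (point_derivation_poly phiP dP) -/a -/dX normcM derivXn hornerMn hornerXn.
  rewrite -mulr_natl normcM normcX a_eq1 expr1n mulr1.
  have -> : normc (n%:R : C) = n%:R.
    by rewrite -(rmorph_nat (real_complex R)) normc_real ger0_norm.
  apply=> x; rewrite poly_eltE hornerXn normcX exprn_ile1 ?normc_ge0//.
  by have [] : X (set_val x) by exact: set_valP.
have [_ sH _ _ tH] := HP.
(* From n0 on, a lies in the disc served by stage n, whose test function has norm at most 2 and a
   derivative of modulus at least n at a. *)
pose n0 := (Num.truncn (2 / (1 - normc a))).+1.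
apply: (@natmul_bounded_eq0 _ (M * 2) n0) => [|n nn0]; first exact: normc_ge0.
have an : normc a <= 1 - 2 * n.+2%:R^-1.
  apply: le_one_sub_inv => //; apply: le_trans (ltW (truncnS_gt _)) _.
  by rewrite ler_nat (leq_trans nn0)// -addn2 leq_addr.
have [s [sP sB sD]] := tH n a an.
have sX p : p \in s -> ~ X p.2 by move=> /sP h [_ /(_ n.+1)].
have [g [gE dg]] := point_derivation_simple_poles phiP dP sX.
have Xout z : X z -> ~ in_discs (H n.+1) z by move=> [_]; exact.
have := dle g 2 ltac:(by []); rewrite dg -/a -/dX normcM normcN => h.
apply: le_trans (h _).
  by rewrite ler_wpM2r ?normc_ge0// sD//; exact: Xout.
by move=> x; rewrite gE; apply: sB; apply: Xout; exact: set_valP.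
Qed.

End no_point_derivation.

(** * The dual module *)

Section dual_set.
Variables (R : realType) (A : comBanachAlgType R[i]).
Local Notation C := R[i].

(** Refuting weak amenability takes one concrete bimodule. A' is cut out of the functions A -> C,
    from which it inherits its linear structure. *)
Definition dual_set : set (A -> C) :=
  [set l | (forall c f g, l (c *: f + g) = c * l f + l g) /\
           exists M : R, forall f, `|l f| <= M%:C * `|f|].

Lemma dual_submod : submod_closed (mem dual_set : {pred A -> C}).
Proof.
split=> [|k l m]; rewrite !inE.
  split=> [c f g|]; first by rewrite mulr0 addr0.
  by exists 0 => f; rewrite normr0 mul0r.
move=> [ll [M lM]] [ml [N mN]]; split=> [c f g|].
  have -> : (k *: l + m) (c *: f + g) = k * l (c *: f + g) + m (c *: f + g) by [].
  have -> : (k *: l + m) f = k * l f + m f by [].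
  have -> : (k *: l + m) g = k * l g + m g by [].
  by rewrite ll ml; ring.
exists (normc k * M + N) => f.
have -> : (k *: l + m) f = k * l f + m f by [].
rewrite (le_trans (ler_normD _ _))// rmorphD mulrDl lerD// normrM rmorphM -mulrA.
by rewrite ler_wpM2l.
Qed.

Definition dual : Type := set_type dual_set.

HB.instance Definition _ := Choice.on dual.
HB.instance Definition _ := SubType.on dual.

HB.instance Definition _ := GRing.SubChoice_isSubLmodule.Build C (A -> C)
  (mem dual_set) dual (GRing.submod_closed_semi dual_submod).

Definition dual_norm (l : dual) : C :=
  (sup [set normc (val l f) | f in [set f : A | `|f| <= 1]])%:C.

Lemma dual_lin (l : dual) c f g : val l (c *: f + g) = c * val l f + val l g.
Proof. by have [+ _] : dual_set (val l) by exact: set_valP. Qed.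

Lemma dual0 (l : dual) : val l 0 = 0.
Proof.
by have := dual_lin l (-1) 0 0; rewrite scaler0 addr0 mulN1r addNr.
Qed.

Lemma dualZ (l : dual) c f : val l (c *: f) = c * val l f.
Proof. by rewrite -[c *: f]addr0 dual_lin dual0 addr0. Qed.

Lemma dual_normP (l : dual) f : `|val l f| <= dual_norm l * `|f|.
Proof.
have [_ [M lM]] : dual_set (val l) by exact: set_valP.
have [->|f0] := eqVneq f 0; first by rewrite dual0 !normr0 mulr0.
have nf0 : 0 < `|f| by rewrite normr_gt0.
rewrite -[leLHS]mulr1 -(mulVf (lt0r_neq0 nf0)) mulrA ler_pM2r//.
have -> : `|val l f| / `|f| = (normc (val l (`|f|^-1 *: f)))%:C.
  rewrite dualZ; transitivity (`| `|f|^-1 * val l f|); last by [].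
  by rewrite normrM mulrC; congr (_ * _); rewrite ger0_norm// invr_ge0 ltW.
rewrite lecR; apply: ub_le_sup; last first.
  exists (`|f|^-1 *: f) => //=.
  by rewrite normrZ ger0_norm ?invr_ge0 ?(ltW nf0)// mulVf// lt0r_neq0.
exists `|M| => _ [g /= g1 <-]; rewrite -lecR; apply: (le_trans (lM g)).
apply: (@le_trans _ _ (`|M|%:C * `|g|)).
  by rewrite ler_wpM2r// lecR ler_norm.
by rewrite ler_piMr// ler0c.
Qed.

Lemma dual_norm_le (l : dual) (M : R) :
  (forall f, `|val l f| <= M%:C * `|f|) -> 0 <= M -> dual_norm l <= M%:C.
Proof.
move=> lM M0; rewrite lecR; apply: ge_sup.
  by exists (normc (val l 0)), 0 => //=; rewrite normr0.
move=> _ [f /= f1 <-]; rewrite -lecR; apply: (le_trans (lM f)).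
by rewrite ler_piMr// ler0c.
Qed.

Lemma dual_norm_ge0 (l : dual) : 0 <= dual_norm l.
Proof.
have [_ [M lM]] : dual_set (val l) by exact: set_valP.
rewrite ler0c; apply: ub_le_sup; last first.
  by exists 0; rewrite /= ?normr0// dual0 normc0.
exists `|M| => _ [g /= g1 <-]; rewrite -lecR; apply: (le_trans (lM g)).
apply: (@le_trans _ _ (`|M|%:C * `|g|)).
  by rewrite ler_wpM2r// lecR ler_norm.
by rewrite ler_piMr// ler0c.
Qed.

Lemma dual_norm_le_C (l : dual) (M : C) : 0 <= M ->
  (forall f, `|val l f| <= M * `|f|) -> dual_norm l <= M.
Proof.
move=> M0; rewrite -(RRe_real (ger0_real M0)) => h; apply: dual_norm_le => //.
by rewrite -ler0c RRe_real// ger0_real.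
Qed.

Lemma dual_ler_normD (l m : dual) : dual_norm (l + m) <= dual_norm l + dual_norm m.
Proof.
apply: dual_norm_le_C => [|f]; first by rewrite addr_ge0 ?dual_norm_ge0.
rewrite raddfD /= (le_trans (ler_normD _ _))// mulrDl lerD ?dual_normP//.
Qed.

Lemma dual_normrZ_le (k : C) (l : dual) : dual_norm (k *: l) <= `|k| * dual_norm l.
Proof.
apply: dual_norm_le_C => [|f]; first by rewrite mulr_ge0 ?dual_norm_ge0.
have -> : val (k *: l) f = k * val l f by rewrite linearZ.
by rewrite normrM -mulrA ler_wpM2l ?dual_normP.
Qed.

Lemma dual_normrZ (k : C) (l : dual) : dual_norm (k *: l) = `|k| * dual_norm l.
Proof.
apply/le_anti; rewrite dual_normrZ_le /=.
have [->|k0] := eqVneq k 0; first by rewrite normr0 mul0r dual_norm_ge0.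
rewrite mulrC -ler_pdivlMr ?normr_gt0// mulrC -normfV.
by rewrite -[in leLHS](scalerK k0 l) dual_normrZ_le.
Qed.

Lemma dual_normr0_eq0 (l : dual) : dual_norm l = 0 -> l = 0.
Proof.
move=> l0; apply/val_inj; rewrite raddf0; apply/funext => f.
by apply/eqP; rewrite -normr_le0; have := dual_normP l f; rewrite l0 mul0r.
Qed.

HB.instance Definition _ := Lmodule_isNormed.Build C dual
  dual_ler_normD dual_normrZ dual_normr0_eq0.

Lemma dual_normE (l : dual) : `|l| = dual_norm l. Proof. by []. Qed.

(** A Cauchy filter converges pointwise; the estimate [gP], relative to |f|, makes the limit bounded
    and the convergence one in norm. *)
Lemma dual_complete (F : set_system dual) : ProperFilter F -> cauchy F -> cvg F.
Proof.
move=> FF /(@cauchyP C dual) Fc.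
have diff (l m : dual) f : `|val l f - val m f| <= `|l - m| * `|f|.
  by have := dual_normP (l - m) f; rewrite raddfB.
have Ff f : cvg ((fun l : dual => val l f) @ F).
  apply: cauchy_cvg; apply/(@cauchyP C C) => e e0.
  have f1 : 0 < `|f| + 1 by rewrite ltr_wpDl.
  have [l Fl] := Fc (e / (`|f| + 1)) ltac:(by rewrite divr_gt0).
  exists (val l f).
  apply: (@filterS _ F _ _ _ _ Fl) => m; rewrite -!ball_normE /= => lm.
  apply: (le_lt_trans (diff _ _ _)).
  move: lm; rewrite ltr_pdivlMr//; apply: le_lt_trans.
  by rewrite ler_wpM2l// lerDl.
pose g f := lim ((fun l : dual => val l f) @ F).
have gcvg f : (fun l : dual => val l f) @ F --> g f by exact: Ff.
have gP (e : C) l : F (ball l e) -> forall f, `|val l f - g f| <= e * `|f|.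
  move=> Fle f; apply/ler_addgt0Pr => d d0.
  have /cvgrPdist_lt/(_ _ d0) gf := gcvg f.
  near F => h.
  have -> : val l f - g f = (val l f - val h f) + (val h f - g f).
    by rewrite addrA subrK.
  rewrite (le_trans (ler_normD _ _))// lerD//.
    have : ball l e h by near: h.
    rewrite -ball_normE /= => /ltW lh; apply: (le_trans (diff _ _ _)).
    by rewrite ler_wpM2r.
  by rewrite distrC ltW//; near: h.
have gdual : dual_set g.
  split=> [c f f'|].
    have h : (fun l : dual => val l (c *: f + f')) @ F --> c * g f + g f'.
      rewrite (_ : (fun l : dual => _) = (fun l : dual => c * val l f + val l f')).
        exact: (@cvgD _ _ _ _ _ (fun l : dual => c * val l f) (fun l : dual => val l f')
          _ _ (@cvgM _ _ _ _ (fun=> c) (fun l : dual => val l f) _ _ (cvg_cst c) (gcvg f))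
          (gcvg f')).
      by apply/funext => l; rewrite dual_lin.
    exact: norm_cvg_unique (gcvg _) h.
  have [l Fl] := Fc 1 ltr01.
  exists (complex.Re (dual_norm l + 1)) => f.
  rewrite RRe_real; last by rewrite ger0_real// addr_ge0// dual_norm_ge0.
  have -> : g f = val l f - (val l f - g f) by rewrite opprB addrC subrK.
  rewrite (le_trans (ler_normB _ _))// mulrDl lerD ?dual_normP//.
  exact: gP.
apply/cvg_ex; exists (exist _ g (mem_set gdual) : dual).
apply/cvgrPdist_le => e e0.
have e2 : 0 < e / 2 by rewrite divr_gt0.
have [l Fl] := Fc _ e2.
near=> h.
have lh : `|l - h| <= e / 2.
  by have : ball l (e / 2) h by [near: h]; rewrite -ball_normE => /ltW.
rewrite dual_normE; apply: dual_norm_le_C => [|f]; first exact: ltW.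
rewrite raddfB (_ : (_ - _) f = (g f - val l f) + (val l f - val h f)).
  rewrite (le_trans (ler_normD _ _))// [e in leRHS]splitr mulrDl lerD//.
    by rewrite distrC gP.
  by apply: (le_trans (diff _ _ _)); rewrite ler_wpM2r.
by rewrite addrA subrK.
Unshelve. all: by end_near. Qed.

HB.instance Definition _ := Uniform_isComplete.Build dual dual_complete.

Lemma dual_act_subproof (a : A) (l : dual) : dual_set (fun h => val l (a ** h)).
Proof.
split=> [c f g|].
  by rewrite bmulC bmulDl bmulZl dual_lin !(bmulC a).
exists (complex.Re (dual_norm l * `|a|)) => f.
rewrite RRe_real; last by rewrite ger0_real// mulr_ge0// dual_norm_ge0.
apply: (le_trans (dual_normP _ _)); rewrite -mulrA ler_wpM2l ?dual_norm_ge0//.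
exact: bnormM.
Qed.

Definition dual_act (a : A) (l : dual) : dual :=
  exist _ (fun h => val l (a ** h)) (mem_set (dual_act_subproof a l)).

Lemma dual_ext (l m : dual) : (forall f, val l f = val m f) -> l = m.
Proof. by move=> lm; apply/val_inj/funext. Qed.

Lemma dual_addE (l m : dual) f : val (l + m) f = val l f + val m f.
Proof. by rewrite raddfD. Qed.

Lemma dual_scaleE c (l : dual) f : val (c *: l) f = c * val l f.
Proof. by rewrite linearZ. Qed.

Lemma dual_actE a (l : dual) f : val (dual_act a l) f = val l (a ** f).
Proof. by []. Qed.

Lemma dual_actDl a b l : dual_act (a + b) l = dual_act a l + dual_act b l.
Proof.
apply: dual_ext => f; rewrite dual_addE !dual_actE bmulDl.
by rewrite -[a ** f]scale1r dual_lin mul1r scale1r.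
Qed.

Lemma dual_actDr a l m : dual_act a (l + m) = dual_act a l + dual_act a m.
Proof. by apply: dual_ext => f; rewrite dual_addE !dual_actE dual_addE. Qed.

Lemma dual_actZl k a l : dual_act (k *: a) l = k *: dual_act a l.
Proof.
by apply: dual_ext => f; rewrite dual_scaleE !dual_actE bmulZl dualZ.
Qed.

Lemma dual_actZr k a l : dual_act a (k *: l) = k *: dual_act a l.
Proof. by apply: dual_ext => f; rewrite dual_scaleE !dual_actE dual_scaleE. Qed.

Lemma dual_actA a b l : dual_act (a ** b) l = dual_act a (dual_act b l).
Proof. by apply: dual_ext => f; rewrite !dual_actE bmulA (bmulC b a). Qed.

Lemma dual_act_bounded : exists M : C,
  forall a l, `|dual_act a l| <= M * `|a| * `|l|.
Proof.
exists 1 => a l; rewrite mul1r dual_normE; apply: dual_norm_le_C => [|f].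
  by rewrite mulr_ge0.
rewrite dual_actE (le_trans (dual_normP _ _))// mulrAC [leRHS]mulrC.
by rewrite ler_wpM2l ?bnormM ?dual_norm_ge0.
Qed.

Definition dual_bimod : comBanachBimod A :=
  @ComBanachBimod _ A dual dual_act dual_actDl dual_actDr dual_actZl dual_actZr
    dual_actA dual_act_bounded.

End dual_set.

(** * The derivation into the dual module *)

Section boundary_derivation.
Variable R : realType.
Local Notation C := R[i].

Lemma div_succ_small (Q e : R) : 0 < e ->
  exists N, forall n, (N <= n)%N -> Q / n.+1%:R <= e.
Proof.
move=> e0; exists (Num.truncn (Q / e)) => n Nn.
rewrite ler_pdivrMr ?ltr0n// mulrC -ler_pdivrMr//.
by apply: (le_trans (ltW (truncnS_gt _))); rewrite ler_nat.
Qed.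

Lemma eq_cvg_seq (u v : nat -> C) (l : C) : u =1 v -> u @ \oo --> l ->
  v @ \oo --> l.
Proof. by move=> uv; have -> : v = u by apply/funext => n; rewrite uv. Qed.

Lemma cvg_lincomb (c : C) (u v : nat -> C) (l m : C) : u @ \oo --> l ->
  v @ \oo --> m -> (fun n => c * u n + v n) @ \oo --> c * l + m.
Proof.
move=> ul vm.
exact: (@cvgD _ _ _ _ _ (fun n => c * u n) v _ _
  (@cvgM _ _ _ _ (fun=> c) u _ _ (cvg_cst c) ul) vm).
Qed.

Lemma cvg_of_rate (u : nat -> C) (v : C) (Q : R) :
  (forall n, normc (v - u n) <= Q / n.+1%:R) -> u @ \oo --> v.
Proof.
move=> uv; apply/cvgrPdist_le => e e0.
have [N NQ] := @div_succ_small Q (complex.Re e) (ltac:(by rewrite -ltcR -gt0_complexE)).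
exists N => // n /= Nn; rewrite (gt0_complexE e0) lecR.
exact: le_trans (uv n) (NQ n Nn).
Qed.

Lemma cvg_of_cauchy_rate (u : nat -> C) (Q : R) :
  (forall n m, normc (u n - u m) <= Q * (n.+1%:R^-1 + m.+1%:R^-1)) ->
  cvg (u @ \oo).
Proof.
move=> uQ; apply: cauchy_cvg; apply/(@cauchyP C C) => e e0.
have e1 : 0 < complex.Re e by rewrite -ltcR -gt0_complexE.
have [N NQ] := @div_succ_small Q (complex.Re e / 3) ltac:(lra).
exists (u N); exists N => // n /= Nn; rewrite -ball_normE /= (gt0_complexE e0) ltcR.
apply: (le_lt_trans (uQ N n)).
rewrite mulrDr; move: (NQ N (leqnn _)) (NQ n Nn) e1.
move: (Q / N.+1%:R) (Q / n.+1%:R) (complex.Re e) => s t r; lra.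
Qed.

Lemma normc_lim_le (u : nat -> C) (v : C) (B Q : R) : u @ \oo --> v ->
  (forall n, normc (u n) <= B + Q / n.+1%:R) -> normc v <= B.
Proof.
move=> uv uB; apply/ler_addgt0Pr => e e0.
have e2 : 0 < (e / 2)%:C :> C by rewrite ltcR; lra.
have /cvgrPdist_le/(_ _ e2)[N _ NP] := uv.
have [M MQ] := @div_succ_small Q (e / 2) ltac:(lra).
pose n := maxn N M.
have := NP n (leq_maxl _ _); rewrite lecR => h1.
have := ler_dist_normc v (u n); move: (MQ n (leq_maxr _ _)) (uB n) h1.
move: (Q / _) (normc (v - u n)) (normc (u n)) => s t r; lra.
Qed.

(** * Extension of the pairing to R(X) *)

Variable H : nat -> seq (C * R).
Hypothesis HP : stages_spec H.
Local Notation X := (cheese H).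
Local Notation A := (RX (@cheese_compact R H)).
Local Notation ratlX := (ratl (fun a => ~ cheese H a)).
Implicit Types f g h : A.

Definition RX_normr f : R := complex.Re `|f|.

Lemma RX_normrE f : `|f| = (RX_normr f)%:C.
Proof. by rewrite RRe_real// normr_real. Qed.

Lemma RX_normr_ge0 f : 0 <= RX_normr f.
Proof. by rewrite -ler0c -RX_normrE. Qed.

Lemma normc_val_le f x : normc (val f x) <= RX_normr f.
Proof. by rewrite -lecR -RX_normrE; exact: RX_normP. Qed.

Definition dist_le f (F : C -> C) (e : R) := forall x : X, normc (val f x - F (set_val x)) <= e.

Lemma dist_le_bound f (F : C -> C) e z : dist_le f F e -> X z -> normc (F z) <= RX_normr f + e.
Proof.
move=> fF Xz; have := fF (exist _ z (mem_set Xz)).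
have := normc_val_le f (exist _ z (mem_set Xz)).
set w := val f _; have -> : set_val (exist _ z (mem_set Xz)) = z by [].
by have := ler_dist_normc (F z) w; rewrite normcB; lra.
Qed.

Lemma dist_le_dist f (F : C -> C) F' e e' z : dist_le f F e -> dist_le f F' e' -> X z ->
  normc (F z - F' z) <= e + e'.
Proof.
move=> fF fF' Xz; have := fF (exist _ z (mem_set Xz)).
have := fF' (exist _ z (mem_set Xz)).
set w := val f _; have -> : set_val (exist _ z (mem_set Xz)) = z by [].
by have := le_normcD (F z - w) (w - F' z); rewrite addrA subrK (normcB _ w); lra.
Qed.

(** [get] is arbitrary where no mean exists; [pairing_bound] supplies one for rational functions. *)
Definition pairing (F1 G : C -> C) : C :=
  get [set v | has_mean (fun z => z * F1 z * G z) v].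

Lemma pairingE F1 G v : has_mean (fun z => z * F1 z * G z) v -> pairing F1 G = v.
Proof.
move=> Hv; have h : has_mean (fun z => z * F1 z * G z) (pairing F1 G).
  exact: (@getI _ [set v | has_mean (fun z => z * F1 z * G z) v] v Hv).
exact: has_mean_unique h Hv.
Qed.

Lemma pairing_bound (F F1 G G1 : C -> C) (a b : R) : ratlX F F1 -> ratlX G G1 ->
  (forall z, X z -> normc (F z) <= a) -> (forall z, X z -> normc (G z) <= b) ->
  has_mean (fun z => z * F1 z * G z) (pairing F1 G) /\
  normc (pairing F1 G) <= 6 * a * b.
Proof.
move=> rF rG Fa Gb; have [v vm vb] := cheese_pairing HP rF rG Fa Gb.
by rewrite (pairingE vm).
Qed.

(** Bilinearity: <F, G> - <F', G'> = <F - F', G> + <F', G - G'>. Only uniform distances between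
    functions enter, no distance between derivatives. *)
Lemma pairing_dist f g F F1 F' F1' G G1 G' G1' (e e' d d' : R) :
  ratlX F F1 -> ratlX F' F1' -> ratlX G G1 -> ratlX G' G1' ->
  dist_le f F e -> dist_le f F' e' -> dist_le g G d -> dist_le g G' d' ->
  normc (pairing F1 G - pairing F1' G') <=
    6 * (e + e') * (RX_normr g + d) + 6 * (RX_normr f + e') * (d + d').
Proof.
move=> rF rF' rG rG' fF fF' gG gG'.
have [m1 _] := pairing_bound rF rG (fun z => dist_le_bound fF) (fun z => dist_le_bound gG).
have [m2 _] := pairing_bound rF' rG' (fun z => dist_le_bound fF') (fun z => dist_le_bound gG').
have rFF := ratlD rF (ratlZ (-1) rF'); have rGG := ratlD rG (ratlZ (-1) rG').
have FF z : X z -> normc (F z + -1 * F' z) <= e + e'.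
  by move=> Xz; rewrite mulN1r; exact: dist_le_dist fF fF' Xz.
have GG z : X z -> normc (G z + -1 * G' z) <= d + d'.
  by move=> Xz; rewrite mulN1r; exact: dist_le_dist gG gG' Xz.
have [m3 b3] := pairing_bound rFF rG FF (fun z => dist_le_bound gG).
have [m4 b4] := pairing_bound rF' rGG (fun z => dist_le_bound fF') GG.
set v3 := pairing _ G in m3 b3; set v4 := pairing F1' _ in m4 b4.
have -> : pairing F1 G - pairing F1' G' = v3 + v4.
  apply: (has_mean_unique _ (has_meanD m3 m4)).
  have := has_meanD m1 (has_meanZ (-1) m2); rewrite mulN1r.
  by apply: eq_has_mean => z _; ring.
exact: le_trans (le_normcD _ _) (lerD b3 b4).
Qed.

(** A rate K / (n + 1) with free K is stable under linear combinations and products, so approximants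
    of a product may be products of approximants. *)
Definition approx_seq f (F F1 : nat -> C -> C) :=
  (forall n, ratlX (F n) (F1 n)) /\
  exists2 K : R, 0 <= K & forall n, dist_le f (F n) (K / n.+1%:R).

Lemma cheese1 : X 1.
Proof. by apply: (boundary_cheese HP (n := 0)); left; exact: normc1. Qed.

Lemma exists_approx_seq f : exists FF : (nat -> C -> C) * (nat -> C -> C),
  approx_seq f FF.1 FF.2.
Proof.
have h n : exists FF : (C -> C) * (C -> C),
    ratlX FF.1 FF.2 /\ dist_le f FF.1 (1 / n.+1%:R).
  have [p [q [hq fpq]]] := @fraction_elt_approx R X (@cheese_compact R H) f
    (1 / n.+1%:R) ltac:(by rewrite divr_gt0).
  (* 1 lies in X, so a q without zeros on X is not the zero polynomial. *)
  have q0 : q != 0.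
    by apply/eqP => qE; have := hq 1 cheese1; rewrite qE horner0 eqxx.
  have hq' z : ~ ~ X z -> q.[z] != 0 by move=> /contrapT; exact: hq.
  have [F1 rF] := ratl_fraction p hq' q0.
  exists ((fun z => p.[z] / q.[z]), F1); split=> //= x.
  have := RX_normP (f - fraction_elt (@cheese_compact R H) p hq) x.
  rewrite val_addA val_oppA fraction_eltE => h; rewrite -lecR.
  exact: le_trans h fpq.
have [FF hFF] := choice h.
exists (fun n => (FF n).1, fun n => (FF n).2); split=> [n|]; first by have [] := hFF n.
by exists 1 => // n; have [] := hFF n.
Qed.

Definition approx f := projT1 (cid (exists_approx_seq f)).

Lemma approxP f : approx_seq f (approx f).1 (approx f).2.
Proof. by rewrite /approx; case: cid. Qed.

Lemma pairing_rate f g F F1 G G1 F' F1' G' G1' :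
  approx_seq f F F1 -> approx_seq g G G1 ->
  approx_seq f F' F1' -> approx_seq g G' G1' ->
  exists Q : R, forall n m, normc (pairing (F1 n) (G n) - pairing (F1' m) (G' m)) <=
    Q * (n.+1%:R^-1 + m.+1%:R^-1).
Proof.
move=> [rF [K1 K10 fF]] [rG [K2 K20 gG]] [rF' [K3 K30 fF']] [rG' [K4 K40 gG']].
exists (6 * (K1 + K3) * (RX_normr g + K2) + 6 * (RX_normr f + K3) * (K2 + K4)) => n m.
apply: (le_trans (pairing_dist (rF n) (rF' m) (rG n) (rG' m) (fF n) (fF' m) (gG n) (gG' m))).
have nf := RX_normr_ge0 f; have ng := RX_normr_ge0 g.
have s0 : 0 <= n.+1%:R^-1 :> R by rewrite invr_ge0.
have t0 : 0 <= m.+1%:R^-1 :> R by rewrite invr_ge0.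
have s1 : n.+1%:R^-1 <= 1 :> R by rewrite invf_le1 ?ltr0n// ler1n.
have t1 : m.+1%:R^-1 <= 1 :> R by rewrite invf_le1 ?ltr0n// ler1n.
move: (n.+1%:R^-1 : R) (m.+1%:R^-1 : R) s0 t0 s1 t1 => s t s0 t0 s1 t1.
rewrite [leRHS]mulrDl lerD//.
  have -> : 6 * (K1 + K3) * (RX_normr g + K2) * (s + t) =
    6 * ((K1 + K3) * (s + t)) * (RX_normr g + K2) by ring.
  have k1 : K1 * s + K3 * t <= (K1 + K3) * (s + t).
    have := mulr_ge0 K10 t0; have := mulr_ge0 K30 s0; lra.
  have k2 : RX_normr g + K2 * s <= RX_normr g + K2 by rewrite lerD2l ler_piMr.
  rewrite ler_pM ?ler_pM2l// ?mulr_ge0 ?addr_ge0 ?mulr_ge0//.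
have -> : 6 * (RX_normr f + K3) * (K2 + K4) * (s + t) =
    6 * (RX_normr f + K3) * ((K2 + K4) * (s + t)) by ring.
have k1 : K2 * s + K4 * t <= (K2 + K4) * (s + t).
  have := mulr_ge0 K20 t0; have := mulr_ge0 K40 s0; lra.
have k2 : RX_normr f + K3 * t <= RX_normr f + K3 by rewrite lerD2l ler_piMr.
by rewrite ler_pM ?ler_pM2l// ?mulr_ge0 ?addr_ge0 ?mulr_ge0.
Qed.

Definition bform f g : C :=
  lim ((fun n => pairing ((approx f).2 n) ((approx g).1 n)) @ \oo).

(** The limit is the same for all approximants. Linearity and the Leibniz rule for [bform] then
    follow from identities that hold at each n for suitably combined approximants. *)
Lemma pairing_cvg f g F F1 G G1 : approx_seq f F F1 -> approx_seq g G G1 ->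
  (fun n => pairing (F1 n) (G n)) @ \oo --> bform f g.
Proof.
move=> fF gG; have [fA gA] := (approxP f, approxP g).
have lim_bform : (fun n => pairing ((approx f).2 n) ((approx g).1 n)) @ \oo --> bform f g.
  have [Q QP] := pairing_rate fA gA fA gA.
  exact: cvg_of_cauchy_rate QP.
have [Q QP] := pairing_rate fF gG fA gA.
rewrite -[bform f g]add0r.
have d0 : (fun n => pairing (F1 n) (G n) -
    pairing ((approx f).2 n) ((approx g).1 n)) @ \oo --> (0 : C).
  apply: (@cvg_of_rate _ _ (2 * Q)) => n; rewrite sub0r normcN.
  by apply: (le_trans (QP n n)); rewrite -mulr2n -[_ *+ 2]mulr_natl mulrA (mulrC Q).
by apply: eq_cvg_seq (cvgD d0 lim_bform) => n; rewrite /= subrK.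
Qed.

Lemma approx_seq_lin c f g F F1 G G1 : approx_seq f F F1 -> approx_seq g G G1 ->
  approx_seq (c *: f + g) (fun n z => c * F n z + G n z)
    (fun n z => c * F1 n z + G1 n z).
Proof.
move=> [rF [K1 K10 fF]] [rG [K2 K20 gG]]; split=> [n|].
  exact: ratlD (ratlZ c (rF n)) (rG n).
exists (normc c * K1 + K2); first by rewrite addr_ge0 ?mulr_ge0 ?normc_ge0.
move=> n x; rewrite val_addA val_scaleA opprD addrACA -mulrBr.
rewrite (le_trans (le_normcD _ _))// mulrDl lerD ?gG// normcM -mulrA.
by rewrite ler_wpM2l ?normc_ge0 ?fF.
Qed.

Lemma approx_seq_mul f g F F1 G G1 : approx_seq f F F1 -> approx_seq g G G1 ->
  approx_seq (f ** g) (fun n z => F n z * G n z)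
    (fun n z => F1 n z * G n z + F n z * G1 n z).
Proof.
move=> [rF [K1 K10 fF]] [rG [K2 K20 gG]]; split=> [n|].
  exact: ratlM (rF n) (rG n).
have [nf ng] := (RX_normr_ge0 f, RX_normr_ge0 g).
exists (RX_normr f * K2 + K1 * (RX_normr g + K2)).
  by rewrite addr_ge0 ?mulr_ge0 ?addr_ge0.
move=> n x; rewrite val_bmul.
have -> : val f x * val g x - F n (set_val x) * G n (set_val x) =
  val f x * (val g x - G n (set_val x)) + (val f x - F n (set_val x)) * G n (set_val x).
  by ring.
have s0 : 0 <= n.+1%:R^-1 :> R by rewrite invr_ge0.
have s1 : n.+1%:R^-1 <= 1 :> R by rewrite invf_le1 ?ltr0n// ler1n.
rewrite (le_trans (le_normcD _ _))// [leRHS]mulrDl lerD// normcM.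
  by rewrite -mulrA ler_pM ?normc_ge0 ?normc_val_le ?gG.
rewrite mulrAC ler_pM ?normc_ge0 ?fF//.
apply: (le_trans (dist_le_bound (gG n) (set_valP x))).
by rewrite lerD2l ler_piMr.
Qed.

Lemma pairing_mean f g F F1 G G1 n : approx_seq f F F1 -> approx_seq g G G1 ->
  has_mean (fun z => z * F1 n z * G n z) (pairing (F1 n) (G n)).
Proof.
move=> [rF [K1 _ fF]] [rG [K2 _ gG]].
by have [] := pairing_bound (rF n) (rG n) (fun z => dist_le_bound (fF n))
  (fun z => dist_le_bound (gG n)).
Qed.

Lemma bform_linr f c g h : bform f (c *: g + h) = c * bform f g + bform f h.
Proof.
have [fA gA hA] := And3 (approxP f) (approxP g) (approxP h).
have gh := approx_seq_lin c gA hA.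
have l1 := pairing_cvg fA gh.
have l2 := @cvg_lincomb c _ _ _ _ (pairing_cvg fA gA) (pairing_cvg fA hA).
apply: norm_cvg_unique l1 _; apply: eq_cvg_seq l2 => n /=.
apply/esym; apply: pairingE.
have := has_meanD (has_meanZ c (pairing_mean n fA gA)) (pairing_mean n fA hA).
by apply: eq_has_mean => z _; ring.
Qed.

Lemma bform_linl c f g h : bform (c *: f + g) h = c * bform f h + bform g h.
Proof.
have [fA gA hA] := And3 (approxP f) (approxP g) (approxP h).
have fg := approx_seq_lin c fA gA.
have l1 := pairing_cvg fg hA.
have l2 := @cvg_lincomb c _ _ _ _ (pairing_cvg fA hA) (pairing_cvg gA hA).
apply: norm_cvg_unique l1 _; apply: eq_cvg_seq l2 => n /=.
apply/esym; apply: pairingE.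
have := has_meanD (has_meanZ c (pairing_mean n fA hA)) (pairing_mean n gA hA).
by apply: eq_has_mean => z _; ring.
Qed.

Lemma bform_leibniz f g h : bform (f ** g) h = bform g (f ** h) + bform f (g ** h).
Proof.
have [fA gA hA] := And3 (approxP f) (approxP g) (approxP h).
have fg := approx_seq_mul fA gA; have fh := approx_seq_mul fA hA.
have gh := approx_seq_mul gA hA.
have l1 := pairing_cvg fg hA.
have l2 := @cvg_lincomb 1 _ _ _ _ (pairing_cvg gA fh) (pairing_cvg fA gh).
rewrite mul1r in l2.
apply: norm_cvg_unique l1 _; apply: eq_cvg_seq l2 => n /=.
apply/esym; apply: pairingE.
have := has_meanD (has_meanZ 1 (pairing_mean n gA fh)) (pairing_mean n fA gh).
by apply: eq_has_mean => z _; ring.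
Qed.

Lemma bform_bound f g : normc (bform f g) <= 6 * RX_normr f * RX_normr g.
Proof.
have [[rF [K1 K10 fF]] [rG [K2 K20 gG]]] := (approxP f, approxP g).
have [nf ng] := (RX_normr_ge0 f, RX_normr_ge0 g).
pose Q := 6 * (RX_normr f * K2 + K1 * RX_normr g + K1 * K2).
apply: (@normc_lim_le _ _ _ Q (pairing_cvg (approxP f) (approxP g))) => n.
have [_] := pairing_bound (rF n) (rG n) (fun z => dist_le_bound (fF n))
  (fun z => dist_le_bound (gG n)).
move=> h; apply: (le_trans h).
have s0 : 0 <= n.+1%:R^-1 :> R by rewrite invr_ge0.
have s1 : n.+1%:R^-1 <= 1 :> R by rewrite invf_le1 ?ltr0n// ler1n.
move: (n.+1%:R^-1 : R) s0 s1 => s s0 s1.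
have : K1 * K2 * (s * s) <= K1 * K2 * s.
  by rewrite ler_wpM2l ?mulr_ge0// ler_piMr.
rewrite /Q; lra.
Qed.

End boundary_derivation.

(** * The derivation is bounded and non-zero *)

Section boundary_derivation.
Variable R : realType.
Local Notation C := R[i].
Variable H : nat -> seq (C * R).
Hypothesis HP : stages_spec H.
Local Notation X := (cheese H).
Local Notation cX := (@cheese_compact R H).
Local Notation A := (RX cX).

Lemma bform_dual (f : A) : dual_set (bform HP f).
Proof.
split=> [c g h|]; first exact: bform_linr.
exists (6 * RX_normr f) => g; rewrite RX_normrE -rmorphM lecR.
exact: bform_bound.
Qed.

Definition boundary_der (f : A) : dual A :=
  exist _ (bform HP f) (mem_set (bform_dual f)).

Lemma boundary_der_linear : linear boundary_der.
Proof.
move=> c f g; apply: dual_ext => h; rewrite dual_addE dual_scaleE.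
exact: bform_linl.
Qed.

HB.instance Definition _ :=
  GRing.isLinear.Build C A (dual A) *:%R boundary_der boundary_der_linear.

Lemma boundary_der_continuous : continuous boundary_der.
Proof.
apply: (@bound_continuous_linear _ _ _ boundary_der 6) => f.
rewrite dual_normE RX_normrE -rmorphM; apply: dual_norm_le => [g|].
  by rewrite RX_normrE -rmorphM lecR; exact: bform_bound.
by rewrite mulr_ge0// RX_normr_ge0.
Qed.

Lemma boundary_der_derivation : derivation (E := dual_bimod A) boundary_der.
Proof.
move=> f g; apply: dual_ext => h.
rewrite [RHS]dual_addE !dual_actE.
exact: bform_leibniz.
Qed.

(** z is paired with 1/z, which is in R(X) because 0 is removed: the integrand is the constant 1. *)
Lemma boundary_der_neq0 : exists f, boundary_der f != 0.
Proof.
exists (poly_elt cX 'X); apply/eqP => D0.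
have nX0 : ~ X 0.
  move=> [_ /(_ 0%N)]; apply; exists (0, 1 / 4); first by case: HP.
  by rewrite /fst /snd subrr normc0; lra.
have hq z : X z -> ('X : {poly C}).[z] != 0.
  by move=> Xz; rewrite hornerX; apply: contra_notN nX0 => /eqP <-.
have b0 : bform HP (poly_elt cX 'X) (fraction_elt cX 1 hq) = 0.
  rewrite -[LHS]/(val (boundary_der (poly_elt cX 'X)) (fraction_elt cX 1 hq)).
  by rewrite D0 raddf0.
(* Both functions are rational, so constant sequences with K = 0 serve, written in the shape of
   [ratl_mono] and [ratl_pole]. *)
have zA : approx_seq (poly_elt cX 'X) (fun _ z => 1 * z ^+ 1)
    (fun _ z => 1 * (1%:R * z ^+ 0)).
  split=> [_|]; first exact: ratl_mono.
  exists 0 => // n x; rewrite poly_eltE hornerX mul1r expr1 subrr normc0.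
  by rewrite mul0r.
have wA : approx_seq (fraction_elt cX 1 hq) (fun _ z => 1 * (z - 0)^-1 ^+ 1)
    (fun _ z => 1 * (- 1%:R * (z - 0)^-1 ^+ 2)).
  split=> [_|]; first exact: ratl_pole.
  exists 0 => // n x; rewrite fraction_eltE hornerX hornerC mul1r subr0 expr1 div1r.
  by rewrite subrr normc0 mul0r.
have b1 : bform HP (poly_elt cX 'X) (fraction_elt cX 1 hq) = 1.
  have l1 : (fun=> 1 : C) @ \oo --> bform HP (poly_elt cX 'X) (fraction_elt cX 1 hq).
    have h := pairing_cvg zA wA.
    apply: eq_cvg_seq (h HP) => n; apply: pairingE.
    have := has_mean_disc (@disc_approx_cst R 1); apply: eq_has_mean => z z1.
    have z0 := normc1_neq0 z1.
    by rewrite subr0 !mul1r !mulr1 mulfV.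
  have l2 : (fun=> 1 : C) @ \oo --> (1 : C) by exact: cvg_cst.
  exact: norm_cvg_unique l1 l2.
by have /eqP := b1; rewrite b0 eq_sym oner_eq0.
Qed.

Theorem cheese_not_weakly_amenable : ~ weakly_amenable A.
Proof.
move=> wA; have [f /eqP] := boundary_der_neq0; apply.
exact: (wA (dual_bimod A) boundary_der boundary_der_continuous boundary_der_derivation f).
Qed.

End boundary_derivation.

Theorem mainTheorem2 (R : realType) :
  exists (X : set R[i]) (cX : compact X),
    ~ has_nonzero_bounded_point_derivation (RX cX) /\
    ~ weakly_amenable (RX cX).
Proof.
have [H HP] := exists_stages R.
exists (cheese H), (@cheese_compact R H); split.
  exact: cheese_no_bounded_point_derivation.
exact: cheese_not_weakly_amenable.
Qed.
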